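(* Let $\nu>0$ and $0<\alpha<1$. There exist exact global smooth Navier--Stokes shear solutions $u^r$ on $\mathbb{T}^3$, indexed by small $r>0$, with $M^r=\mathbb{E}\nabla A^r$ the mean deformation of the stochastic (Constantin--Iyer) flow of $u^r$ itself, such that $\|u^r_0\|_{L^2(\mathbb{T}^3)}=1$ for every $r$, while $$\sup_{t>0}\,\|M^r(t)\|_{C^\alpha}\ \longrightarrow\ \infty\qquad(r\downarrow0).$$
   Context: $\mathbb{T}^3=\mathbb{R}^3/\mathbb{Z}^3$. The Navier--Stokes equations are $\partial_tu+(u\cdot\nabla)u-\nu\Delta u+\nabla p=0$, $\operatorname{div}u=0$, $u(0)=u_0$. A shear solution is one of the form $u(t,x)=(e^{\nu t\Delta_\perp}f_0(x_2,x_3),0,0)$ with $\Delta_\perp=\partial_2^2+\partial_3^2$ and $f_0$ of zero mean on $\mathbb{T}^2$. For a solution $u$, the Constantin--Iyer flow is $\mathrm{d}X_t(a)=u(t,X_t(a))\,\mathrm{d}t+\sqrt{2\nu}\,\mathrm{d}W_t$, $X_0(a)=a$, with a single 3-dimensional Brownian motion $W$ common to all labels $a$; $A_t:=X_t^{-1}$ and the mean deformation is $M(t,x)=\mathbb{E}\nabla A_t(x)$, $(\nabla A)_{ij}=\partial_jA_i$. $u^r_0$ is the initial datum of $u^r$, and $A^r$ is the inverse flow of $u^r$. Matrix norms are operator norms; $\|\cdot\|_{C^\alpha}$ is the sup norm plus the $\alpha$-Hölder seminorm. *)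

(* Defs.v *)
From HB Require Import structures.
From mathcomp Require Export all_boot all_order all_algebra.
From mathcomp Require Export all_classical all_reals all_analysis.
Export Order.TTheory GRing.Theory Num.Theory.
Export numFieldNormedType.Exports.

Set Implicit Arguments.
Unset Strict Implicit.
Unset Printing Implicit Defensive.

Local Open Scope classical_set_scope.
Local Open Scope ring_scope.

(** Functions on the torus T^n = R^n/Z^n are represented by their Z^n-periodic
    lifts to R^n; R^3 is ['rV[R]_3], with coordinates x 0 0, x 0 1, x 0 2 for
    x_1, x_2, x_3. *)

Section Torus.
Context {R : realType}.

Definition periodic3 (T : Type) (g : 'rV[R]_3 -> T) : Prop :=
  forall (x : 'rV[R]_3) (k : 'rV[int]_3), g (x + map_mx intr k) = g x.

Definition periodic2 (T : Type) (g : R -> R -> T) : Prop :=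
  forall (y z : R) (k l : int), g (y + k%:~R) (z + l%:~R) = g y z.

Definition integral01 (g : R -> R) : R :=
  \int[@lebesgue_measure R]_(y in `[0, 1]) g y.

(* Integration over T^2 and T^3 as iterated Lebesgue integrals over the unit
   cube; only used on continuous functions. *)
Definition integralT2 (g : R -> R -> R) : R :=
  integral01 (fun y => integral01 (fun z => g y z)).

Definition integralT3 (g : 'rV[R]_3 -> R) : R :=
  integral01 (fun a => integral01 (fun b => integral01 (fun c =>
    g (\row_(j < 3) [:: a; b; c]`_j)))).

(* The library norm on matrices is the max norm, hence the next two
   definitions. *)
Definition enorm m n (v : 'M[R]_(m, n)) : R :=
  Num.sqrt (\sum_i \sum_j v i j ^+ 2).

Definition opnorm n (B : 'M[R]_n) : R :=
  sup [set enorm (B *m v) | v in [set v : 'cV[R]_n | enorm v <= 1]].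

Definition L2norm (v : 'rV[R]_3 -> 'rV[R]_3) : R :=
  Num.sqrt (integralT3 (fun x => enorm (v x) ^+ 2)).

Definition torus_dist (x y : 'rV[R]_3) : R :=
  inf [set enorm (x - y + map_mx intr k) | k in [set: 'rV[int]_3]].

Definition supnorm (B : 'rV[R]_3 -> 'M[R]_3) : \bar R :=
  ereal_sup [set (opnorm (B x))%:E | x in [set: 'rV[R]_3]].

Definition holder_seminorm (alpha : R) (B : 'rV[R]_3 -> 'M[R]_3) : \bar R :=
  ereal_sup [set (opnorm (B xy.1 - B xy.2) / torus_dist xy.1 xy.2 `^ alpha)%:E
            | xy in [set xy | 0 < torus_dist xy.1 xy.2]].

Definition Calpha_norm (alpha : R) (B : 'rV[R]_3 -> 'M[R]_3) : \bar R :=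
  (supnorm B + holder_seminorm alpha B)%E.

End Torus.

Section Smoothness.
Context {R : realType}.

Fixpoint iter_derive (V : normedModType R) (vs : seq V) (g : V -> R) : V -> R :=
  if vs is v :: vs' then fun x => 'D_v (iter_derive vs' g) x else g.

(* C^infinity: all iterated directional derivatives exist and are continuous
   (V is finite dimensional in the sequel). *)
Definition smooth (V : normedModType R) (g : V -> R) : Prop :=
  forall vs : seq V, continuous (iter_derive vs g) /\
    forall v x, derivable (iter_derive vs g) x v.

(* Smoothness on [0, +oo[ x R^3 up to the boundary t = 0. *)
Definition smooth_halfspace (g : R -> 'rV[R]_3 -> R) : Prop :=
  exists2 G : (R * 'rV[R]_3)%type -> R, smooth G &
    forall t x, 0 <= t -> g t x = G (t, x).

End Smoothness.

Section NavierStokes.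
Context {R : realType}.
Implicit Types (nu : R) (u : R -> 'rV[R]_3 -> 'rV[R]_3) (p : R -> 'rV[R]_3 -> R).

Definition partial (j : 'I_3) (g : 'rV[R]_3 -> R) (x : 'rV[R]_3) : R :=
  'D_(delta_mx 0 j : 'rV[R]_3) g x.

(* Values at negative times are irrelevant. At t = 0 the equation follows from
   the case t > 0 by smoothness up to the boundary. *)
Definition NS_solution nu u : Prop :=
  exists p, [/\
    (forall i, smooth_halfspace (fun t x => u t x 0 i)) /\ smooth_halfspace p,
    (forall t, 0 <= t -> periodic3 (u t) /\ periodic3 (p t)),
    (forall t x, 0 <= t -> \sum_j partial j (fun y => u t y 0 j) x = 0) &
    (forall t x i, 0 < t ->
       derive1 (fun s => u s x 0 i) t
       + \sum_j u t x 0 j * partial j (fun y => u t y 0 i) x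
       - nu * \sum_j partial j (partial j (fun y => u t y 0 i)) x
       + partial i (p t) x = 0)].

(* e^{nu t Delta} on T^2 as a Fourier multiplier: the sum over k in Z^2 of
     e^{- nu t |2 pi k|^2} * \int_{T^2} f(w) cos (2 pi k . (y - w)) dw,
   which is the real form, for real f, of the sum of
     e^{- nu t |2 pi k|^2} \hat f(k) e^{2 pi i k . y}.
   Partial sums are over -N <= k_1, k_2 <= N. *)
Definition heatT2 nu (t : R) (f : R -> R -> R) (y z : R) : R :=
  limn (fun N : nat =>
    \sum_(m < N.*2.+1) \sum_(n < N.*2.+1)
      let k := m%:R - N%:R in let l := n%:R - N%:R in
      expR (- (nu * t * (2 * pi) ^+ 2 * (k ^+ 2 + l ^+ 2))) *
      integralT2 (fun y' z' =>
        f y' z' * cos (2 * pi * (k * (y - y') + l * (z - z'))))).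

Definition shear_form nu u (f0 : R -> R -> R) : Prop :=
  forall t x, 0 <= t ->
    u t x = \row_(j < 3) if j == 0 then heatT2 nu t f0 (x 0 1) (x 0 2) else 0.

(* Shear solution with profile f0 and initial datum (f0(x_2, x_3), 0, 0). *)
Definition shear_solution nu u : Prop :=
  NS_solution nu u /\
  exists f0 : R -> R -> R, [/\ periodic2 f0,
    integralT2 f0 = 0,
    shear_form nu u f0 &
    forall x, u 0 x = \row_(j < 3) if j == 0 then f0 (x 0 1) (x 0 2) else 0].

End NavierStokes.

Section ConstantinIyer.
Context {R : realType} {d : measure_display} {Omega : measurableType d}.
Context (P : probability Omega R).

(* The product rule for the whole family gives it for every subfamily, on
   taking B k = setT for the other indices. *)
Definition mutually_independent (I : finType) (Y : I -> Omega -> R) : Prop :=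
  forall B : I -> set R, (forall k, measurable (B k)) ->
    P [set w | forall k, B k (Y k w)] = (\prod_k P [set w | B k (Y k w)])%E.

(* Standard 3-dimensional Brownian motion on [0, +oo[. The second parameter of
   normal_prob is the standard deviation. *)
Definition brownian_motion (W : R -> Omega -> 'rV[R]_3) : Prop :=
  [/\ (forall t i, 0 <= t -> measurable_fun setT (fun w => W t w 0 i)),
      {ae P, forall w, W 0 w = 0 /\
         forall i, {within `[0, +oo[, continuous (fun t => W t w 0 i)}},
      (forall s t i, 0 <= s -> s < t ->
         forall B : set R, measurable B ->
         P [set w | B (W t w 0 i - W s w 0 i)]
         = normal_prob 0 (Num.sqrt (t - s)) B) &
      (forall (n : nat) (tau : nat -> R), 0 <= tau 0%N ->
         (forall k, tau k < tau k.+1) ->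
         mutually_independent (fun (ki : 'I_n * 'I_3) w =>
           W (tau ki.1.+1) w 0 ki.2 - W (tau ki.1) w 0 ki.2))].

(* X t w a is X_t(a) at the sample point w. The noise being additive, the
   equation is read path by path; one null set serves all t and a. *)
Definition CI_flow (W : R -> Omega -> 'rV[R]_3) (nu : R)
    (u : R -> 'rV[R]_3 -> 'rV[R]_3) (X : R -> Omega -> 'rV[R]_3 -> 'rV[R]_3) :
    Prop :=
  (forall t a i, 0 <= t -> measurable_fun setT (fun w => X t w a 0 i)) /\
  {ae P, forall w, forall a i,
    {within `[0, +oo[, continuous (fun t => X t w a 0 i)} /\
    forall t, 0 <= t ->
      X t w a 0 i = a 0 i
        + (\int[@lebesgue_measure R]_(s in `[0, t]) u s (X s w a) 0 i)
        + Num.sqrt (2 * nu) * W t w 0 i}.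

Definition inverse_flow (X A : R -> Omega -> 'rV[R]_3 -> 'rV[R]_3) : Prop :=
  {ae P, forall w, forall t, 0 <= t ->
    [/\ cancel (X t w) (A t w), cancel (A t w) (X t w) &
        forall x, differentiable (A t w) x]}.

(* (grad A)_{ij} = \partial_j A_i; the library Jacobian acts on row vectors. *)
Definition grad (g : 'rV[R]_3 -> 'rV[R]_3) (x : 'rV[R]_3) : 'M[R]_3 :=
  ('J g x)^T.

Definition mean_gradient (A : R -> Omega -> 'rV[R]_3 -> 'rV[R]_3)
    (M : R -> 'rV[R]_3 -> 'M[R]_3) : Prop :=
  forall t x i j, 0 <= t ->
    P.-integrable setT (EFin \o (fun w => grad (A t w) x i j)) /\
    (M t x i j)%:E = 'E_P[fun w => grad (A t w) x i j]%E.

(* Flows are unique up to a null set, so M does not depend on the choice of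
   X and A. *)
Definition mean_deformation (W : R -> Omega -> 'rV[R]_3) (nu : R)
    (u : R -> 'rV[R]_3 -> 'rV[R]_3) (M : R -> 'rV[R]_3 -> 'M[R]_3) : Prop :=
  exists X A, [/\ CI_flow W nu u X, inverse_flow X A & mean_gradient A M].

End ConstantinIyer.

(* Main.v *)
(** With N ~ 1/r, take the initial profile
      f0(y, z) = (sqrt 2 / N) * sum_{N < k, l <= 2N} sin (2 pi (k y + l z)),
    which has unit L^2 norm and is concentrated, up to periodicity, at scale 1/N.
    For a shear flow, A_t is explicit: its first component is x_1 minus a
    Brownian increment minus the integral over [0, t] of
      (e^{nu s Delta} f0)(x - sqrt(2 nu) (W_t - W_s)),
    and averaging over W turns this integrand into e^{nu (t - s) Delta} e^{nu s Delta} f0.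
    Hence M(t) = Id - e_1 (x) t grad (e^{nu t Delta} f0).  At time t = 1/N^2 the
    heat factors are bounded below, and over the distance 1/(4N) in the x_2
    direction all the N^2 terms of the sum move M_12 the same way, by an amount
    which is in total bounded below independently of N.  So the Hoelder seminorm
    is at least of order N^alpha. *)

From HB Require Import structures.
Require Import Defs.
From mathcomp Require Import measurable_realfun ring lra zify.

Set Implicit Arguments.
Unset Strict Implicit.
Unset Printing Implicit Defensive.

Local Open Scope classical_set_scope.
Local Open Scope ring_scope.

(** * The characteristic function of the normal law *)

(** A single wave of frequency N and unit energy would not suffice: at the parabolic time 1/N^2 it
    changes [M] by about N^-2 * N = 1/N, and dividing by (1/N)^alpha with alpha < 1 does not make up
    for this. The profile uses N^2 waves of amplitude of order 1/N whose gradients are all in phase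
    at the origin, so that the change is of order N^2 * N^-2 * N^-1 * N = 1. The mean deformation is
    computed without exchanging a derivative with an expectation. Path by path, the inverse flow is
    a trigonometric polynomial in x whose coefficients are random time integrals; it is
    differentiated first, and then only the means of finitely many scalar integrals are needed.
    These come from Fubini in time and chance together with the characteristic function of the
    normal law. Fubini asks for joint measurability, which is why a version of the Brownian motion
    with all paths continuous is constructed. *)

Section Gaussian.
Context {R : realType}.
Implicit Types (s x xi delta : R).
Local Notation mu := (@lebesgue_measure R).

Lemma derivable1_continuous (f : R -> R) :
  (forall x, derivable f x 1) -> continuous f.
Proof.
by move=> df x; exact/differentiable_continuous/derivable1_diffP.
Qed.

Lemma measurable_cos_affine xi delta :
  measurable_fun setT (fun x => cos (xi * x + delta)).
Proof.
by apply: continuous_measurable_fun; apply: derivable1_continuous => x; exact: ex_derive.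
Qed.

Lemma is_derive_normal_pdf s x : s != 0 ->
  is_derive x 1 (normal_pdf 0 s) (- (x / s ^+ 2) * normal_pdf 0 s x).
Proof.
move=> s0; rewrite (normal_pdfE _ s0).
have D : is_derive x 1 (fun y : R => normal_peak s * expR (- (y - 0) ^+ 2 / (s ^+ 2 *+ 2)))
   (- (x / s ^+ 2) * (normal_peak s * normal_fun 0 s x)).
  rewrite /normal_fun; apply: is_derive_eq.
  by rewrite /GRing.scale /=; field.
exact: D.
Qed.

(** Half of the exponent absorbs the factor [|x|]: with u = x^2 / (4 s^2), one has |x| <= |s| (1 +
    u) by the arithmetic-geometric inequality, and 1 + u <= e^u. First moments are thereby dominated
    by a multiple of a wider normal density, and the density itself decays at infinity. *)
Lemma norm_mul_normal_fun_le s x : s != 0 ->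
  `|x| * normal_fun 0 s x <= `|s| * normal_fun 0 (s * Num.sqrt 2) x.
Proof.
move=> s0; rewrite /normal_fun !subr0.
have s2 : (s * Num.sqrt 2) ^+ 2 = 2 * s ^+ 2.
  by rewrite exprMn sqr_sqrtr// mulrC.
set u := x ^+ 2 / (4 * s ^+ 2).
have -> : - x ^+ 2 / (s ^+ 2 *+ 2) = - u - u by rewrite /u; field.
have -> : - x ^+ 2 / ((s * Num.sqrt 2) ^+ 2 *+ 2) = - u by rewrite s2 /u; field.
rewrite expRD mulrA ler_wpM2r ?expR_ge0// expRN ler_pdivrMr ?expR_gt0//.
apply: le_trans (_ : `|s| * (1 + u) <= _); last first.
  by rewrite ler_wpM2l// expR_ge1Dx.
have n0 : 0 < `|s| by rewrite normr_gt0.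
have -> : `|s| * (1 + u) = (4 * `|s| ^+ 2 + `|x| ^+ 2) / (4 * `|s|).
  rewrite /u -(real_normK (num_real x)) -(real_normK (num_real s)).
  by field; rewrite normr_eq0.
rewrite ler_pdivlMr; last by lra.
have := sqr_ge0 (2 * `|s| - `|x|); nra.
Qed.

Lemma integrable_bounded_normal_pdf s (b : R -> R) M : measurable_fun setT b ->
  (forall x, `|b x| <= M) ->
  mu.-integrable setT (fun x => (b x * normal_pdf 0 s x)%:E).
Proof.
move=> mb bM.
apply: (@le_integrable _ _ _ mu _ _ _ (fun x => (M * normal_pdf 0 s x)%:E)) => //.
- by apply/measurable_EFinP/measurable_funM => //; exact: measurable_normal_pdf.
- move=> x _; rewrite lee_fin !normrM ler_wpM2r//.
  by rewrite (le_trans (bM x))// ler_norm.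
- exact: (integrableZl measurableT M (integrable_normal_pdf 0 s)).
Qed.

Lemma integrable_mul_normal_pdf s (b : R -> R) : s != 0 ->
  measurable_fun setT b -> (forall x, `|b x| <= 1) ->
  mu.-integrable setT (fun x => (x * b x * normal_pdf 0 s x)%:E).
Proof.
move=> s0 mb b1; have s20 : s * Num.sqrt 2 != 0.
  by rewrite mulf_neq0// gt_eqF// sqrtr_gt0.
pose C := normal_peak s * `|s| / normal_peak (s * Num.sqrt 2).
apply: (@le_integrable _ _ _ mu _ _ _
  (fun x => (C * normal_pdf 0 (s * Num.sqrt 2) x)%:E)) => //.
- apply/measurable_EFinP/measurable_funM; last exact: measurable_normal_pdf.
  by apply: measurable_funM.
- move=> x _; rewrite lee_fin.
  have C0 : 0 <= C by rewrite /C divr_ge0 ?mulr_ge0 ?normal_peak_ge0.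
  rewrite [leRHS]ger0_norm; last exact: mulr_ge0 C0 (normal_pdf_ge0 _ _ _).
  rewrite !normrM (ger0_norm (normal_pdf_ge0 _ _ _)).
  rewrite (normal_pdfE _ s0) (normal_pdfE _ s20) /C.
  have -> : normal_peak s * `|s| / normal_peak (s * Num.sqrt 2) *
    (normal_peak (s * Num.sqrt 2) * normal_fun 0 (s * Num.sqrt 2) x) =
    normal_peak s * (`|s| * normal_fun 0 (s * Num.sqrt 2) x).
    by field; rewrite gt_eqF// normal_peak_gt0.
  apply: (@le_trans _ _ (normal_peak s * (`|x| * normal_fun 0 s x))); last first.
    by rewrite ler_wpM2l ?normal_peak_ge0// norm_mul_normal_fun_le.
  rewrite mulrCA ler_wpM2l ?normal_peak_ge0// ler_wpM2r ?normal_fun_ge0//.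
  by rewrite ler_piMr.
- exact: (integrableZl measurableT C (integrable_normal_pdf 0 (s * Num.sqrt 2))).
Qed.

Lemma normal_pdf_cvg0 s : s != 0 -> normal_pdf 0 s n%:R @[n --> \oo] --> (0 : R).
Proof.
move=> s0.
have s20 : s * Num.sqrt 2 != 0 by rewrite mulf_neq0// gt_eqF// sqrtr_gt0.
have near_le : \forall n \near \oo, 0 <= normal_pdf 0 s n%:R <=
    normal_peak s * `|s| * (n%:R)^-1.
  near=> n.
  have n0 : (0 : R) < n%:R by rewrite ltr0n; near: n; exists 1%N.
  rewrite normal_pdf_ge0 /= ler_pdivlMr// (normal_pdfE _ s0) -!mulrA.
  rewrite ler_wpM2l ?normal_peak_ge0//.
  have := norm_mul_normal_fun_le n%:R s0; rewrite ger0_norm// mulrC.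
  move=> /le_trans; apply; rewrite ler_piMr// -[leRHS]expR0 ler_expR.
  by rewrite mulNr oppr_le0 divr_ge0 ?mulrn_wge0 ?sqr_ge0.
have cvg_h : normal_peak s * `|s| * (n%:R)^-1 @[n --> \oo] --> (0 : R).
  rewrite -[X in _ --> X](mulr0 (normal_peak s * `|s|)).
  apply: cvgM; first exact: cvg_cst.
  apply/gtr0_cvgV0; last exact: cvgr_idn.
  by near=> n; rewrite ltr0n; near: n; exists 1%N.
exact: (squeeze_cvgr near_le (cvg_cst _) cvg_h).
Unshelve. all: by end_near. Qed.

(* The integrand is the derivative of [s^2 sin (xi x + delta) pdf x]. *)
Lemma integral_derive_sin_normal_pdf s xi delta : s != 0 ->
  \int[mu]_x ((s ^+ 2 * xi * cos (xi * x + delta)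
               - x * sin (xi * x + delta)) * normal_pdf 0 s x) = 0.
Proof.
move=> s0.
pose H x := s ^+ 2 * sin (xi * x + delta) * normal_pdf 0 s x.
pose h x := (s ^+ 2 * xi * cos (xi * x + delta)
               - x * sin (xi * x + delta)) * normal_pdf 0 s x.
have dH x : is_derive x 1 H (h x).
  have dpdf := is_derive_normal_pdf x s0.
  have -> : H = (fun x => s ^+ 2 * sin (xi * x + delta)) \* normal_pdf 0 s by [].
  apply: is_derive_eq.
  by rewrite /h /GRing.scale /=; field.
have cos_b x : `|cos (xi * x + delta)| <= 1 by exact: cos_max.
have ih : mu.-integrable setT (fun x => (h x)%:E).
  rewrite (_ : (fun _ => _) = (fun x => (s ^+ 2 * xi)%:E *
      (cos (xi * x + delta) * normal_pdf 0 s x)%:E -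
      (x * sin (xi * x + delta) * normal_pdf 0 s x)%:E)%E).
    apply: integrableB => //.
      apply: integrableZl => //.
      exact: (integrable_bounded_normal_pdf _ (measurable_cos_affine _ _) cos_b).
    apply: integrable_mul_normal_pdf => [//||x]; last exact: sin_max.
    by under eq_fun do rewrite -cosBpihalf -addrA; exact: measurable_cos_affine.
  by apply/funext => x; rewrite -EFinM -EFinB /h mulrBl mulrA.
have ch : continuous h.
  apply: derivable1_continuous => x.
  have dpdf := is_derive_normal_pdf x s0.
  have -> : h = (fun x => s ^+ 2 * xi * cos (xi * x + delta)
               - x * sin (xi * x + delta)) \* normal_pdf 0 s by [].
  exact: ex_derive.
(* The integral over the line is the limit of integrals over symmetric intervals, whose boundary
   terms vanish in the limit; [n.+1] keeps every interval nondegenerate. *)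
have int_n n : \int[mu]_(x in `[- n.+1%:R, n.+1%:R]) h x = H n.+1%:R - H (- n.+1%:R).
  have cH : continuous H.
    by apply: derivable1_continuous => x; exact: ex_derive.
  rewrite /Rintegral (continuous_FTC2 (F := H))//.
  - by rewrite gtrN.
  - exact: continuous_subspaceT.
  - split => //.
    + by apply: cvg_at_right_filter; exact: cH.
    + by apply: cvg_at_left_filter; exact: cH.
  - by move=> x _; rewrite derive1E; have [_ ->] := dH x.
pose g n x := (h \_ `[- n.+1%:R, n.+1%:R]) x.
have mh : measurable_fun setT h by exact: continuous_measurable_fun.
have mg n : measurable_fun setT (fun x => (g n x)%:E).
  apply/measurable_EFinP/measurable_restrict => //.
  by rewrite setTI; exact: measurable_funTS.
have gh x : setT x -> (g n x)%:E @[n --> \oo] --> (h x)%:E.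
  move=> _; apply: cvg_near_cst; near=> n.
  rewrite /g patchE ifT// inE/= in_itv/= -ler_norml.
  rewrite (@le_trans _ _ n%:R) ?ler_nat//.
  by near: n; exact: nbhs_infty_ger.
have [||||_ _ cvg_int] := @dominated_convergence _ _ _ mu setT measurableT
    (fun n x => (g n x)%:E) (fun x => (h x)%:E) (fun x => `|(h x)%:E|%E) mg.
- exact/measurable_EFinP.
- exact: aeW.
- exact: integrable_abse.
- apply: aeW => x n _ /=; rewrite lee_fin /g patchE.
  by case: ifPn => // _; rewrite normr0.
have {}cvg_int : H n.+1%:R - H (- n.+1%:R) @[n --> \oo] --> \int[mu]_x h x.
  rewrite (_ : (fun n => _) = fun n => fine (\int[mu]_x (g n x)%:E)%E).
    by apply: fine_cvg; rewrite /Rintegral fineK// integrable_fin_num.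
  by apply/funext => n; rewrite -int_n Rintegral_mkcond.
apply: (cvg_unique _ cvg_int) => //.
have H_le n : `|H n.+1%:R - H (- n.+1%:R)| <= 2 * s ^+ 2 * normal_pdf 0 s n.+1%:R.
  have pdfN : normal_pdf 0 s (- n.+1%:R) = normal_pdf 0 s n.+1%:R.
    by rewrite !(normal_pdfE _ s0) /normal_fun !subr0 sqrrN.
  rewrite /H pdfN -mulrBl -mulrBr normrM (ger0_norm (normal_pdf_ge0 _ _ _)).
  rewrite ler_wpM2r ?normal_pdf_ge0// normrM ger0_norm ?sqr_ge0// mulrC.
  rewrite ler_wpM2r ?sqr_ge0// (le_trans (ler_normB _ _))//.
  by rewrite -[leRHS]natr1 lerD ?sin_max.
apply: norm_cvg0; apply: (squeeze_cvgr _ (cvg_cst 0)).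
  by apply: nearW => n; rewrite normr_ge0; exact: H_le.
rewrite -[X in _ --> X](mulr0 (2 * s ^+ 2)); apply: cvgM; first exact: cvg_cst.
by rewrite (cvg_shiftS (fun n => normal_pdf 0 s n%:R)); exact: normal_pdf_cvg0.
Unshelve. all: by end_near. Qed.

(* Differentiating in [xi] gives the equation [F' = - s^2 xi F]. *)
Lemma integral_cos_normal_pdf s xi delta : s != 0 ->
  \int[mu]_x (cos (xi * x + delta) * normal_pdf 0 s x) =
  expR (- (s ^+ 2 * xi ^+ 2 / 2)) * cos delta.
Proof.
move=> s0.
pose F k := \int[mu]_x (cos (k * x + delta) * normal_pdf 0 s x).
have icos xi' : mu.-integrable setT
    (fun x => (cos (xi' * x + delta) * normal_pdf 0 s x)%:E).
  apply: integrable_bounded_normal_pdf (measurable_cos_affine _ _) _ => x.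
  exact: cos_max.
have isin xi' : mu.-integrable setT
    (fun x => (x * sin (xi' * x + delta) * normal_pdf 0 s x)%:E).
  apply: integrable_mul_normal_pdf => [//||x]; last exact: sin_max.
  by under eq_fun do rewrite -cosBpihalf -addrA; exact: measurable_cos_affine.
have dF xi' : is_derive xi' 1 F (- (s ^+ 2 * xi') * F xi').
  pose f k x := cos (k * x + delta) * normal_pdf 0 s x.
  have df (k x : R) : is_derive k 1 (f ^~ x) (- (x * sin (k * x + delta) * normal_pdf 0 s x)).
    rewrite /f; apply: is_derive_eq; rewrite /GRing.scale /=; ring.
  have I : `]xi' - 1, xi' + 1[%classic xi'.
    by rewrite /= in_itv/= ltrBlDr ltrDl ltr01.
  (* A bound for the derivative in [k] that is uniform in [k]; the factor 1 matches
     [integrable_mul_normal_pdf] with constant [b]. *)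
  have G : mu.-integrable setT (fun x => (`|x * 1 * normal_pdf 0 s x|)%:E).
    apply: (integrable_abse (integrable_mul_normal_pdf s0 _ _)) => // x.
    by rewrite normr1.
  have G_ub k x : `]xi' - 1, xi' + 1[%classic k -> setT x ->
      `|partial1of2 f k x| <= `|x * 1 * normal_pdf 0 s x|.
    move=> _ _; rewrite partial1of2E; have [_ ->] := df k x.
    rewrite normrN !normrM ler_wpM2r// ler_wpM2l// normr1; exact: sin_max.
  have dfI k x : `]xi' - 1, xi' + 1[%classic k -> setT x -> derivable (f ^~ x) k 1.
    by move=> _ _; exact: (@ex_derive _ _ _ _ _ _ _ (df k x)).
  have G_ge0 x : 0 <= `|x * 1 * normal_pdf 0 s x| by [].
  have DU := @derivable_under_integral _ _ _ mu f setT measurableT _ _ _ I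
    (fun k _ => icos k) dfI _ G_ge0 G G_ub.
  have DI := @differentiation_under_integral _ _ _ mu f setT measurableT _ _ _ I
    (fun k _ => icos k) dfI _ G_ge0 G G_ub.
  apply: DeriveDef; first exact: DU.
  rewrite -derive1E [LHS]DI.
  have := integral_derive_sin_normal_pdf xi' delta s0.
  under eq_Rintegral do rewrite mulrBl -(mulrA (s ^+ 2 * xi')).
  rewrite RintegralB//; [|exact: (integrableZl measurableT _ (icos xi'))|exact: isin].
  rewrite RintegralZl ?icos// => /eqP; rewrite subr_eq0 => /eqP eqI.
  rewrite mulNr eqI -mulN1r -RintegralZl ?isin//.
  by apply: eq_Rintegral => x _; rewrite partial1of2E mulN1r; have [_ ->] := df xi' x.
(* Integrating factor for the differential equation; the constant is then read off at frequency 0,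
   where [F] is cos delta times the total mass 1. *)
have cst_F : forall x y, F x * expR (s ^+ 2 * x ^+ 2 / 2) = F y * expR (s ^+ 2 * y ^+ 2 / 2).
  move=> x y; apply: (@is_derive_0_is_cst _ (fun x => F x * expR (s ^+ 2 * x ^+ 2 / 2))) => z.
  by apply: is_derive_eq; rewrite /GRing.scale /=; field.
have := cst_F xi 0; rewrite expr0n/= mulr0 mul0r expR0 mulr1.
rewrite /F; under [in RHS]eq_Rintegral do rewrite mul0r add0r.
rewrite RintegralZl//; last exact: integrable_normal_pdf.
rewrite {2}/Rintegral integral_normal_pdf mulr1 => <-.
by rewrite mulrCA -expRD addNr expR0 mulr1.
Qed.

End Gaussian.

Section NormalProb.
Context {R : realType}.
Local Notation mu := (@lebesgue_measure R).

(** The Radon-Nikodym derivative is known only abstractly; it equals the density almost everywhere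
    because both have the same integral over every measurable set. *)
Lemma integral_normal_prob (m s : R) (f : R -> \bar R) :
  (normal_prob m s).-integrable setT f ->
  (\int[normal_prob m s]_x f x = \int[mu]_x (f x * (normal_pdf m s x)%:E))%E.
Proof.
move=> intf; have mf := measurable_int _ intf.
rewrite -(Radon_Nikodym_change_of_variables (normal_prob_dominates m s))//=.
apply: ae_eq_integral => //.
- apply: emeasurable_funM => //; apply: (measurable_int mu).
  by apply: Radon_Nikodym_integrable; exact: normal_prob_dominates.
- apply: emeasurable_funM => //; apply/measurable_EFinP.
  exact: measurable_normal_pdf.
- apply: ae_eqe_mul2l => /=.
  rewrite Radon_NikodymE//=; first exact: normal_prob_dominates.
  move=> dom; case: cid => /= h [h1 h2 h3].
  apply: integral_ae_eq => //=.
  + by apply/measurable_EFinP; exact: measurable_normal_pdf.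
  + by move=> E _ mE; rewrite -h3.
Qed.

Lemma integrable_bounded (d : measure_display) (T : measurableType d)
    (P : {finite_measure set T -> \bar R}) (f : T -> R) (M : R) :
  measurable_fun setT f -> (forall x, `|f x| <= M) ->
  P.-integrable setT (fun x => (f x)%:E).
Proof.
move=> mf fM; apply: measurable_bounded_integrable => //.
  by apply: fin_num_fun_lty; exact: fin_num_measure.
exists M; split; first exact: num_real.
by move=> x Mx y _ /=; exact: le_trans (fM y) (ltW Mx).
Qed.

Lemma integral_cos_normal_prob (s xi delta : R) : s != 0 ->
  (\int[normal_prob 0 s]_x (cos (xi * x + delta))%:E)%E =
  (expR (- (s ^+ 2 * xi ^+ 2 / 2)) * cos delta)%:E.
Proof.
move=> s0.
have i1 : (normal_prob 0 s).-integrable setT (fun x => (cos (xi * x + delta))%:E).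
  apply: (@integrable_bounded _ _ _ _ 1); first exact: measurable_cos_affine.
  by move=> x; exact: cos_max.
rewrite integral_normal_prob// -integral_cos_normal_pdf// /Rintegral fineK//.
apply: integrable_fin_num => //.
by apply: integrable_bounded_normal_pdf (measurable_cos_affine _ _) _ => x; exact: cos_max.
Qed.

End NormalProb.

(** * Brownian increments *)

Section Increments.
Context {R : realType} {d : measure_display} {Omega : measurableType d}.
Variables (P : probability Omega R) (W : R -> Omega -> 'rV[R]_3).
Hypothesis BM : brownian_motion P W.

Lemma joint_law_increments (s t : R) (i j : 'I_3) (A B : set R) :
  0 <= s -> s < t -> i != j -> measurable A -> measurable B ->
  P ([set w | A (W t w 0 i - W s w 0 i)] `&` [set w | B (W t w 0 j - W s w 0 j)]) =
  (normal_prob 0%R (Num.sqrt (t - s)) A * normal_prob 0%R (Num.sqrt (t - s)) B)%E.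
Proof.
move=> s0 st ij mA mB; case: BM => [_ _ law indep].
(* Independence is formulated along an infinite increasing sequence of times, so s < t is continued
   by t + 1, t + 2, ...; with [n = 1] only the increment from s to t enters, and [C] imposes no
   condition on the third coordinate. *)
pose tau k := if k is k'.+1 then t + k'%:R else s.
have tau_lt k : tau k < tau k.+1.
  by case: k => [|k] /=; rewrite ?addr0// ltrD2l ltr_nat.
pose C (ki : 'I_1 * 'I_3) : set R :=
  if ki.2 == i then A else if ki.2 == j then B else setT.
have mC ki : measurable (C ki) by rewrite /C; do 2 case: ifP => //.
have := indep 1%N tau s0 tau_lt C mC.
have -> : [set w | forall ki : 'I_1 * 'I_3, C ki (W (tau ki.1.+1) w 0 ki.2 - W (tau ki.1) w 0 ki.2)]
   = [set w | A (W t w 0 i - W s w 0 i)] `&` [set w | B (W t w 0 j - W s w 0 j)].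
  apply/seteqP; split => w /=.
    move=> H; split.
      by have := H (ord0, i); rewrite /C /= eqxx addr0.
    by have := H (ord0, j); rewrite /C /= eq_sym (negbTE ij) eqxx addr0.
  move=> [HA HB] [k l]; rewrite /C ord1 /= addr0.
  case: ifP => [/eqP ->//|_]; by case: ifP => [/eqP ->//|_].
move=> ->.
rewrite (bigD1 (ord0, i))//= (bigD1 (ord0, j))/=; last by rewrite xpair_eqE/= eq_sym.
rewrite [X in (_ * (_ * X))%E]big1 ?mule1; last first.
  move=> [k l]; rewrite ord1 !xpair_eqE !eqxx/= => /andP[li lj].
  rewrite /C /= (negbTE li) (negbTE lj).
  by rewrite -(probability_setT P); congr (P _); exact/seteqP.
by rewrite /C /= eqxx eq_sym (negbTE ij) eqxx !addr0 !law.
Qed.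

(** Characteristic function of a planar Brownian increment in real form. The free phase lets the
    one-dimensional formula be applied twice, since integrating out one coordinate leaves a cosine
    of the other. *)
Lemma integral_cos_increment (s t a b delta : R) (i j : 'I_3) :
  0 <= s -> s <= t -> i != j ->
  (\int[P]_w (cos (a * (W t w 0 i - W s w 0 i) + b * (W t w 0 j - W s w 0 j) + delta))%:E)%E =
  (expR (- ((t - s) * (a ^+ 2 + b ^+ 2) / 2)) * cos delta)%:E.
Proof.
(* The case s = t is separate: the formula for the normal law requires a nonzero deviation. *)
move=> s0; rewrite le_eqVlt => /predU1P[<- _|st ij].
  under eq_integral do rewrite !subrr !mulr0 !add0r.
  rewrite integral_cst// subrr !mul0r oppr0 expR0 mul1r -[RHS]mule1.
  by congr (_ * _)%E; exact: probability_setT.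
have [mW _ _ _] := BM.
have t0 : 0 <= t by exact: le_trans s0 (ltW st).
have mY k : measurable_fun setT (fun w => W t w 0 k - W s w 0 k).
  by apply: measurable_funB; exact: mW.
pose phi w : measurableTypeR R * measurableTypeR R :=
  (W t w 0 i - W s w 0 i, W t w 0 j - W s w 0 j).
have mphi : measurable_fun setT phi.
  by apply: measurable_fun_pair; [exact: (mY i)|exact: (mY j)].
pose N : probability (measurableTypeR R) R := normal_prob 0 (Num.sqrt (t - s)).
pose F (y : measurableTypeR R * measurableTypeR R) : R := cos (a * y.1 + b * y.2 + delta).
have mF : measurable_fun setT F.
  have -> : F = @cos R \o
      (fun y : measurableTypeR R * measurableTypeR R => a * y.1 + b * y.2 + delta) by [].
  apply: measurableT_comp.
    by apply: continuous_measurable_fun; exact: continuous_cos.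
  apply: measurable_funD => //; apply: measurable_funD.
    by apply: measurable_funM => //; exact: measurable_fst.
  by apply: measurable_funM => //; exact: measurable_snd.
have F1 y : `|F y| <= 1 by exact: cos_max.
pose X : {mfun Omega >-> (measurableTypeR R * measurableTypeR R)%type} :=
  HB.pack phi (isMeasurableFun.Build _ _ _ _ phi mphi).
transitivity (\int[distribution P X]_y (F y)%:E)%E.
  rewrite integral_pushforward//; first exact/measurable_EFinP.
  apply: (@integrable_bounded _ _ _ _ (F \o phi) 1) => // [|w]; last exact: F1.
  exact: measurableT_comp.
(* Independence enters here: a measure with product values on rectangles is the product measure. *)
transitivity (\int[N \x N]_y (F y)%:E)%E.
  apply: eq_measure_integral => Y mY' _; apply/esym.
  apply: product_measure_unique => // A B mA mB.
  by rewrite -(joint_law_increments s0 st ij).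
rewrite -integral12_prod_meas1/fubini_F; last first.
  apply: measurable_bounded_integrable => //.
    rewrite -setXTT; apply: (@le_lt_trans _ _ 1%E); last exact: ltry.
    have /= -> := @product_measure1E _ _ _ _ _ N N setT setT measurableT measurableT.
    have NT : N setT = 1%E := probability_setT N.
    by rewrite NT mule1.
  exists 1; split; first exact: num_real.
  by move=> M M1 y _ /=; exact: le_trans (F1 y) (ltW M1).
have st0 : Num.sqrt (t - s) != 0 by rewrite gt_eqF// sqrtr_gt0 subr_gt0.
(* For fixed x, [a * x + delta] is the phase of the inner integral. *)
transitivity (\int[N]_x ((expR (- ((t - s) * b ^+ 2 / 2)))%:E *
    (cos (a * x + delta))%:E))%E.
  apply: eq_integral => x _; rewrite /F/=.
  under eq_integral do rewrite addrAC addrC.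
  by rewrite integral_cos_normal_prob// sqr_sqrtr ?subr_ge0 ?ltW// EFinM.
rewrite integralZl//; last first.
  apply: (@integrable_bounded _ _ _ N _ 1) => [|x]; last exact: cos_max.
  exact: measurable_cos_affine.
rewrite integral_cos_normal_prob// sqr_sqrtr ?subr_ge0 ?ltW// -EFinM mulrA -expRD.
by congr ((expR _ * _)%:E); ring.
Qed.

End Increments.

(** * Time integrals along continuous paths *)

Section PathIntegral.
Context {R : realType} {d : measure_display} {Omega : measurableType d}.
Local Notation mu := (@lebesgue_measure R).

(** A preimage is a countable union of rectangles, one for each time slab [k / c, (k + 1) / c[. *)
Lemma measurable_fun_floor_step (c : R) (G : int -> Omega -> R) : 0 < c ->
  (forall k, measurable_fun setT (G k)) ->
  measurable_fun setT (fun p : measurableTypeR R * Omega => G (Num.floor (p.1 * c)) p.2).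
Proof.
move=> c0 mG _ Y mY; rewrite setTI.
have -> : (fun p : measurableTypeR R * Omega => G (Num.floor (p.1 * c)) p.2) @^-1` Y =
    \bigcup_k (`[k%:~R / c, (k + 1)%:~R / c[ `*` (G k @^-1` Y)).
  apply/seteqP; split => [p /= Yp|p [k _] /= [/andP[kp pk] Yp]].
    exists (Num.floor (p.1 * c)) => //=; split => //.
    by rewrite in_itv/= ler_pdivrMr// floor_le_tmp ltr_pdivlMr// floorD1_gt.
  suff -> : Num.floor (p.1 * c) = k by [].
  move: kp pk; rewrite !bnd_simp ler_pdivrMr// ltr_pdivlMr// => kp pk.
  by apply/floor_def/andP.
apply: countable_bigcupT_measurable; first exact: countableP.
move=> k; apply: measurableX; first exact: measurable_itv.
by rewrite -[X in measurable X]setTI; exact: mG.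
Qed.

Lemma floor_div_cvg (x : R) : (Num.floor (x * n.+1%:R))%:~R / n.+1%:R @[n --> \oo] --> x.
Proof.
have le_n n : x - n.+1%:R^-1 <= (Num.floor (x * n.+1%:R))%:~R / n.+1%:R <= x.
  rewrite ler_pdivlMr// ler_pdivrMr// floor_le_tmp andbT mulrBl mulVf//.
  by rewrite lerBlDr ltW// -[in ltRHS](intrD _ _ 1) floorD1_gt.
have cvg_l : x - n.+1%:R^-1 @[n --> \oo] --> x.
  rewrite -[X in _ --> X]subr0; apply: cvgB; first exact: cvg_cst.
  exact: cvg_harmonic.
apply: (squeeze_cvgr _ cvg_l (cvg_cst x)); exact: nearW.
Qed.

(** By continuity the process is the pointwise limit of the step processes that freeze it at the
    last grid time j / (n + 1). *)
Lemma measurable_fun_continuous_path (g : R -> Omega -> R) :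
  (forall s, measurable_fun setT (g s)) -> (forall w, continuous (g ^~ w)) ->
  measurable_fun setT (fun p : measurableTypeR R * Omega => g p.1 p.2).
Proof.
move=> mg cg.
apply: (@measurable_fun_cvg _ _ _ _ (fun n (p : measurableTypeR R * Omega) =>
  g ((Num.floor (p.1 * n.+1%:R))%:~R / n.+1%:R) p.2)) => [n|p _].
  by apply: (measurable_fun_floor_step (G := fun k => g (k%:~R / n.+1%:R))) => //.
exact: (cvg_comp _ _ (@floor_div_cvg p.1) (cg p.2 p.1)).
Qed.

Lemma lebesgue_measure_itv0_lty (t : R) : (mu `[0%R, t]%classic < +oo)%E.
Proof. by rewrite lebesgue_measure_itv/=; case: ifP => // _; rewrite ltry. Qed.

Lemma integrable_continuous_itv0 (f : R -> R) (t : R) : continuous f ->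
  mu.-integrable `[0, t] (EFin \o f).
Proof.
move=> cf; apply: continuous_compact_integrable; first exact: segment_compact.
exact: continuous_subspaceT.
Qed.

Variable P : probability Omega R.

Section bounded.
Variables (h : R -> Omega -> R) (M t : R).
Hypothesis M0 : 0 <= M.
Hypothesis mh : measurable_fun setT (fun p : measurableTypeR R * Omega => h p.1 p.2).
Hypothesis hM : forall s w, 0 <= s <= t -> `|h s w| <= M.

(** Extension by 0 outside [[0, t]], so that Fubini can be applied to the product of the full
    Lebesgue measure with [P]. *)
Let f (p : measurableTypeR R * Omega) := (h p.1 p.2 * \1_`[0, t] p.1)%:E.

Let measurable_section s : measurable_fun setT (h s).
Proof. exact: (measurableT_comp mh (pair1_measurable (T1 := measurableTypeR R) s)). Qed.

Let mf : measurable_fun setT f.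
Proof.
apply/measurable_EFinP/measurable_funM => //.
have -> : (fun p : measurableTypeR R * Omega => \1_`[0, t] p.1 : R) =
  \1_`[0, t] \o fst by [].
by apply: measurableT_comp; [exact: measurable_indic|exact: measurable_fst].
Qed.

Let intf : (mu \x P)%E.-integrable setT f.
Proof.
apply/integrable12ltyP => //.
have mI : measurable_fun setT (fun x : measurableTypeR R => (M * \1_`[0, t] x)%:E).
  by apply/measurable_EFinP/measurable_funM => //; exact: measurable_indic.
apply: (@le_lt_trans _ _ (\int[mu]_x (M * \1_`[0, t] x)%:E)%E).
  apply: ge0_le_integral => //=.
  - by move=> x _; exact: integral_ge0.
  - have mfabs : measurable_fun setT (abse \o f) by exact: measurableT_comp.
    exact: (@measurable_fun_fubini_tonelli_F _ _ _ _ _ P _ mfabs (fun=> abse_ge0 _)).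
  move=> x _; apply: (@le_trans _ _ (\int[P]_y (M * \1_`[0, t] x)%:E)%E).
    apply: ge0_le_integral => //=.
    - apply: measurableT_comp => //; apply: measurableT_comp => //.
      by apply: measurable_funM; [exact: measurable_section|exact: measurable_cst].
    - move=> y _; rewrite lee_fin normrM [X in _ * X]ger0_norm// indicE.
      case: (boolP (x \in _)) => [|_]; last by rewrite !mulr0.
      by rewrite inE/= in_itv/= !mulr1; exact: hM.
  by rewrite integral_cst//= probability_setT mule1.
under eq_integral do rewrite EFinM.
rewrite ge0_integralZl//; last first.
  by apply/measurable_EFinP; exact: measurable_indic.
rewrite integral_indic// setIT; apply: lte_mul_pinfty => //.
exact: lebesgue_measure_itv0_lty.
Qed.

Let sectionE w : (\int[mu]_(s in `[0, t]) h s w)%:E = (\int[mu]_s f (s, w))%E.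
Proof.
have mhw : measurable_fun setT (h ^~ w).
  exact: (measurableT_comp mh (pair2_measurable (T1 := measurableTypeR R) w)).
rewrite /Rintegral fineK; last first.
  apply: integrable_fin_num => //; apply: measurable_bounded_integrable => //.
  - exact: lebesgue_measure_itv0_lty.
  - exact: measurable_funTS.
  - exists M; split; first exact: num_real.
    by move=> N MN s /= st; apply: le_trans (hM _ _) (ltW MN); move: st; rewrite in_itv.
rewrite integral_mkcond; apply: eq_integral => s _.
by rewrite patchE /f /= indicE; case: ifP => _; rewrite ?mulr1 ?mulr0.
Qed.

Lemma measurable_path_integral :
  measurable_fun setT (fun w => \int[mu]_(s in `[0, t]) h s w).
Proof.
apply/measurable_EFinP; rewrite (_ : _ \o _ = fubini_G mu f).
  exact: (measurable_fubini_G intf).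
by apply/funext => w; exact: sectionE.
Qed.

Lemma integral_path_integral (e : R -> R) : continuous e ->
  (forall s, 0 <= s <= t -> (\int[P]_w (h s w)%:E = (e s)%:E)%E) ->
  (\int[P]_w (\int[mu]_(s in `[0, t]) h s w)%:E = (\int[mu]_(s in `[0, t]) e s)%:E)%E.
Proof.
move=> ce eh; under eq_integral do rewrite sectionE.
rewrite -(Fubini intf) /Rintegral fineK; last first.
  by apply: integrable_fin_num => //; exact: integrable_continuous_itv0.
rewrite [RHS]integral_mkcond; apply: eq_integral => s _.
rewrite patchE /f /= indicE; case: ifPn => [|_]; last first.
  by under eq_integral do rewrite mulr0; rewrite integral0.
rewrite inE/= in_itv/= => s0t.
by under eq_integral do rewrite mulr1; exact: eh.
Qed.

End bounded.
End PathIntegral.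

Section Paths.
Context {R : realType}.
Local Notation mu := (@lebesgue_measure R).

Lemma continuous_integral_itv0 (f : R -> R) : continuous f ->
  {within `[0, +oo[, continuous (fun t => \int[mu]_(s in `[0, t]) f s)}.
Proof.
move=> cf; apply/subspace_continuousP => t; rewrite /= in_itv/= andbT => t0.
(* The known continuity result concerns a compact interval; ending it at t + 1 leaves room to the
   right of t, so near t it gives continuity within the half-line. *)
have t1 : 0 <= t + 1 by rewrite addr_ge0.
have := parameterized_integral_continuous t1 (integrable_continuous_itv0 (t + 1) cf).
move=> /subspace_continuousP/(_ t); rewrite /= in_itv/= t0 lerDl ler01.
move=> /(_ isT) Ft B /Ft HB.
have {}HB : \forall s \near t, `[0, t + 1]%classic s -> B (\int[mu]_(s in `[0, s]) f s) := HB.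
suff : \forall s \near t, `[0, +oo[%classic s -> B (\int[mu]_(s in `[0, s]) f s) by [].
have lt1 : \forall s \near t, s < t + 1 by apply: lt_nbhsl; rewrite ltrDl.
apply: filterS2 lt1 HB => s st H; rewrite /= in_itv/= andbT => s0.
by apply: H; rewrite /= in_itv/= s0 ltW.
Qed.

Lemma continuous_comp_normr (f : R -> R) :
  {within `[0, +oo[, continuous f} -> continuous (fun t : R => f `|t|).
Proof.
move=> /subspace_continuousP cf t.
have t0 : `[0, +oo[%classic `|t| by rewrite /= in_itv/= normr_ge0.
apply: (cvg_comp _ _ _ (cf _ t0)) => B; rewrite /= /within/= => HB.
have : \forall s \near t, `[0, +oo[%classic `|s| -> B `|s| by exact: (@norm_continuous _ R t _ HB).
by apply: filterS => s; apply; rewrite /= in_itv/= normr_ge0.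
Qed.

(* Every path of the version is continuous on the whole of R, because it is set
   to 0 on a null set and reflected at time 0. *)
Lemma brownian_continuous_version (d : measure_display) (Omega : measurableType d)
    (P : probability Omega R) (W : R -> Omega -> 'rV[R]_3) :
  brownian_motion P W ->
  exists V : 'I_3 -> R -> Omega -> R,
    [/\ forall i t, measurable_fun setT (V i t),
        forall i w, continuous (V i ^~ w) &
        {ae P, forall w, forall i t, 0 <= t -> V i t w = W t w 0 i}].
Proof.
move=> [mW [N [mN PN subN]] _ _].
exists (fun i t w => W `|t| w 0 i * \1_(~` N) w); split.
- move=> i t; apply: measurable_funM; first exact: mW.
  by apply: measurable_indic; exact: measurableC.
- move=> i w; rewrite indicE; case: (boolP (w \in ~` N)) => wN.
    under eq_fun do rewrite mulr1.
    apply: (@continuous_comp_normr (fun t => W t w 0 i)).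
    have : W 0 w = 0 /\ forall i, {within `[0, +oo[, continuous (fun t => W t w 0 i)}.
      by apply: contrapT => /subN; move: wN; rewrite inE.
    by case.
  by under eq_fun do rewrite mulr0; exact: cst_continuous.
- exists N; split => // w H; apply: contrapT => wN; apply: H => i t t0.
  by rewrite ger0_norm// indicE mem_set// mulr1.
Qed.

End Paths.

(** * Trigonometric polynomials on the torus *)

Section Trigonometric.
Context {R : realType}.
Local Notation mu := (@lebesgue_measure R).
Implicit Types (theta y z : R) (n : int).

Lemma sinD2pin n theta : sin (theta + 2 * pi * n%:~R) = sin theta.
Proof.
have Dn (m : nat) (x : R) : sin (x + 2 * pi * m%:R) = sin x.
  by rewrite -[RHS](periodicn (@sinD2pi R) m); congr sin; rewrite !mulr_natr mulr_natl.
case: n => m; first exact: Dn.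
by rewrite NegzE mulrNz mulrN -[LHS](Dn m.+1) subrK.
Qed.

Lemma cosD2pin n theta : cos (theta + 2 * pi * n%:~R) = cos theta.
Proof. by rewrite -!sinDpihalf addrAC sinD2pin. Qed.

Lemma integral01_cst (c : R) : integral01 (fun=> c) = c.
Proof.
rewrite /integral01 Rintegral_cst//= lebesgue_measure_itv/= lte01/=.
by rewrite oppr0 addr0 mulr1.
Qed.

(** The phase [theta] will carry the other variable, so one statement serves both integrations over
    T^2. *)
Lemma integral01_sin n theta :
  integral01 (fun y => sin (2 * pi * n%:~R * y + theta)) = (n == 0)%:R * sin theta.
Proof.
have [->|n0] := eqVneq n 0.
  by under eq_fun do rewrite mulr0 mul0r add0r; rewrite integral01_cst mul1r.
set a := 2 * pi * n%:~R.
have a0 : a != 0 by rewrite !mulf_neq0// ?intr_eq0// gt_eqF// pi_gt0.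
pose F y := - (cos (a * y + theta) / a).
have dF y : is_derive y 1 F (sin (a * y + theta)).
  by rewrite /F; apply: is_derive_eq; rewrite /GRing.scale /=; field.
have cF : continuous F.
  by apply: derivable1_continuous => y; exact: ex_derive.
rewrite /integral01 /Rintegral (continuous_FTC2 (F := F))//=.
- by rewrite /F mulr1 mulr0 add0r (addrC a) /a cosD2pin subrr mul0r.
- apply: continuous_subspaceT; apply: derivable1_continuous => y; exact: ex_derive.
- split => //.
  + by apply: cvg_at_right_filter; exact: cF.
  + by apply: cvg_at_left_filter; exact: cF.
- by move=> y _; rewrite derive1E; have [_ ->] := dF y.
Qed.

Lemma continuous_big_sum (J : Type) (s : seq J) (f : J -> R -> R) :
  (forall j, continuous (f j)) -> continuous (fun y => \sum_(j <- s) f j y).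
Proof.
move=> cf; elim: s => [|j s IHs]; first by under eq_fun do rewrite big_nil; exact: cst_continuous.
by under eq_fun do rewrite big_cons; move=> y; apply: cvgD; [exact: cf|exact: IHs].
Qed.

Lemma Rintegral_itv0_sum (t : R) (J : finType) (a : J -> R) (g : J -> R -> R) :
  (forall j, continuous (g j)) ->
  \int[mu]_(s in `[0, t]) (\sum_j a j * g j s) =
  \sum_j a j * \int[mu]_(s in `[0, t]) g j s.
Proof.
move=> cg.
have cag j : continuous (fun y => a j * g j y).
  by move=> y; apply: cvgM; [exact: cvg_cst|exact: cg].
elim: (index_enum J) => [|j s IHs].
  by rewrite big_nil; under eq_Rintegral do rewrite big_nil; rewrite Rintegral_cst// mul0r.
rewrite big_cons -IHs; under eq_Rintegral do rewrite big_cons.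
rewrite RintegralD//=; [|exact/integrable_continuous_itv0/cag|
  exact/integrable_continuous_itv0/continuous_big_sum].
by rewrite RintegralZl//; exact/integrable_continuous_itv0/cg.
Qed.

Lemma integral01_sum (J : finType) (a : J -> R) (g : J -> R -> R) :
  (forall j, continuous (g j)) ->
  integral01 (fun y => \sum_j a j * g j y) = \sum_j a j * integral01 (g j).
Proof. exact: Rintegral_itv0_sum. Qed.

Lemma continuous_sin_affine (a b : R) : continuous (fun y => sin (a * y + b)).
Proof. by apply: derivable1_continuous => y; exact: ex_derive. Qed.

(** Orthogonality in the single form used below: means, energies and Fourier coefficients are all
    brought to such a sum by product-to-sum formulas. *)
Lemma integralT2_trig (J : finType) (a theta : J -> R) (m n : J -> int) :
  integralT2 (fun y z => \sum_j a j *
    sin (2 * pi * ((m j)%:~R * y + (n j)%:~R * z) + theta j)) =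
  \sum_j a j * ((m j == 0) && (n j == 0))%:R * sin (theta j).
Proof.
rewrite /integralT2.
transitivity (integral01 (fun y => \sum_j (a j * (n j == 0)%:R) *
    sin (2 * pi * (m j)%:~R * y + theta j))).
  congr integral01; apply/funext => y.
  transitivity (integral01 (fun z => \sum_j a j *
      sin (2 * pi * (n j)%:~R * z + (2 * pi * (m j)%:~R * y + theta j)))).
    congr integral01; apply/funext => z; apply: eq_bigr => j _.
    by congr (_ * sin _); ring.
  rewrite integral01_sum; last by move=> j; exact: continuous_sin_affine.
  by apply: eq_bigr => j _; rewrite integral01_sin mulrA.
rewrite integral01_sum; last by move=> j; exact: continuous_sin_affine.
apply: eq_bigr => j _; rewrite integral01_sin.
by case: (m j == 0); case: (n j == 0) => /=; ring.
Qed.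

End Trigonometric.

Section Packet.
Context {R : realType} (I : finType) (k l : I -> nat).
Implicit Types (C delta : I -> R) (y z : R).

(** The phases [delta] make packets stable under differentiation, which multiplies coefficients by
    frequencies and adds pi / 2 to each phase. *)
Definition packet C delta y z : R :=
  \sum_i C i * sin (2 * pi * ((k i)%:R * y + (l i)%:R * z) + delta i).

Lemma periodic2_packet C delta : periodic2 (packet C delta).
Proof.
move=> y z m n; apply: eq_bigr => i _; congr (_ * _).
rewrite -[RHS](sinD2pin ((k i)%:Z * m + (l i)%:Z * n)) intrD !intrM.
by congr sin; rewrite -!pmulrn; ring.
Qed.

Hypothesis k_gt0 : forall i, (0 < k i)%N.

Lemma integralT2_packet C delta : integralT2 (packet C delta) = 0.
Proof.
have := integralT2_trig C delta (fun i => (k i)%:Z) (fun i => (l i)%:Z).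
rewrite /packet => ->; apply: big1 => i _.
by rewrite eqz_nat gtn_eqF// mulr0 mul0r.
Qed.

(** Product-to-sum formula with sines only, in the shape of [integralT2_trig]: [b = false] gives -
    cos (A + B) / 2 and [b = true] gives cos (A - B) / 2. *)
Lemma sinM_sum_sign (A B : R) :
  sin A * sin B = \sum_(b : bool) 2^-1 * sin (A + (-1) ^+ b * (B - pi / 2)).
Proof.
rewrite big_bool /= expr1 expr0 mulN1r mul1r opprB addrA addrA.
by rewrite sinBpihalf addrAC sinDpihalf cosB cosD; field.
Qed.

Lemma sinM_cos_sum_sign (A B : R) :
  sin A * cos B = \sum_(b : bool) 2^-1 * sin (A + (-1) ^+ b * B).
Proof.
by rewrite big_bool /= expr1 expr0 mulN1r mul1r sinB sinD; field.
Qed.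

Hypothesis kl_inj : injective (fun i => (k i, l i)).

(** Parseval's identity. Sum frequencies never vanish because the [k i] are positive; difference
    frequencies vanish in both coordinates only on the diagonal, by [kl_inj]. *)
Lemma integralT2_packet_sqr C :
  integralT2 (fun y z => packet C (fun=> 0) y z ^+ 2) = \sum_i C i ^+ 2 / 2.
Proof.
pose m (p : I * (I * bool)) : int := (k p.1)%:Z + (-1) ^+ p.2.2 * (k p.2.1)%:Z.
pose n (p : I * (I * bool)) : int := (l p.1)%:Z + (-1) ^+ p.2.2 * (l p.2.1)%:Z.
pose a (p : I * (I * bool)) : R := C p.1 * C p.2.1 / 2.
pose th (p : I * (I * bool)) : R := (-1) ^+ p.2.2 * - (pi / 2).
transitivity (integralT2 (fun y z => \sum_p a p *
    sin (2 * pi * ((m p)%:~R * y + (n p)%:~R * z) + th p))).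
  congr integralT2; apply/funext => y; apply/funext => z.
  rewrite expr2 /packet mulr_suml.
  rewrite -(pair_bigA _ (fun i q => a (i, q) *
    sin (2 * pi * ((m (i, q))%:~R * y + (n (i, q))%:~R * z) + th (i, q)))) /=.
  apply: eq_bigr => i _; rewrite mulr_sumr.
  rewrite -(pair_bigA _ (fun j b => a (i, (j, b)) *
    sin (2 * pi * ((m (i, (j, b)))%:~R * y + (n (i, (j, b)))%:~R * z) + th (i, (j, b))))) /=.
  apply: eq_bigr => j _; rewrite mulrACA sinM_sum_sign mulr_sumr.
  apply: eq_bigr => b _; rewrite mulrA; congr (_ * sin _).
  by rewrite /m /n /th /= !intrD !intrM !rmorphXn /= !rmorphN1 -!pmulrn; ring.
rewrite integralT2_trig.
rewrite -(pair_bigA _ (fun i q => a (i, q) *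
  ((m (i, q) == 0) && (n (i, q) == 0))%:R * sin (th (i, q)))) /=.
apply: eq_bigr => i _.
rewrite -(pair_bigA _ (fun j b => a (i, (j, b)) *
  ((m (i, (j, b)) == 0) && (n (i, (j, b)) == 0))%:R * sin (th (i, (j, b))))) /=.
rewrite (bigD1 i)//= [X in _ + X]big1 => [|j ji]; last first.
  rewrite big_bool /m /n /=.
  rewrite expr1 expr0 !mulN1r !mul1r !subr_eq0 !eqz_nat.
  have -> : (k i + k j == 0)%N = false by rewrite addn_eq0 gtn_eqF.
  have -> : (k i == k j) && (l i == l j) = false.
    by apply: contra_neqF ji => /andP[/eqP kij /eqP lij]; apply: kl_inj; rewrite kij lij.
  by rewrite /= !mulr0 !mul0r addr0.
rewrite addr0 big_bool /m /n /a /th /= expr1 expr0 !mulN1r !mul1r !subr_eq0 !eqxx.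
have -> : ((k i)%:Z + (k i)%:Z == 0) = false by rewrite -PoszD eqz_nat addn_eq0 gtn_eqF.
by rewrite /= mulr0 mul0r addr0 opprK sin_pihalf !mulr1 expr2.
Qed.

End Packet.

Lemma enorm_row_head {R : realType} (c : R) :
  enorm (\row_(j < 3) if j == 0 then c else 0) ^+ 2 = c ^+ 2.
Proof.
rewrite /enorm sqr_sqrtr; last by do 2 apply: sumr_ge0 => ? _; exact: sqr_ge0.
rewrite big_ord1 !big_ord_recl big_ord0 !mxE /=.
by rewrite expr0n/= !addr0.
Qed.

Lemma L2norm_shear {R : realType} (g : R -> R -> R) :
  L2norm (fun x : 'rV[R]_3 => \row_(j < 3) if j == 0 then g (x 0 1) (x 0 2) else 0) =
  Num.sqrt (integralT2 (fun y z => g y z ^+ 2)).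
Proof.
rewrite /L2norm /integralT3; congr Num.sqrt.
rewrite -[RHS]integral01_cst; congr integral01; apply/funext => a.
rewrite /integralT2; congr integral01; apply/funext => b.
congr integral01; apply/funext => c.
by rewrite enorm_row_head !mxE.
Qed.

(** The partial sums in [heatT2] index the frequency m - N by m = 0, ..., 2N, so the frequency x is
    met exactly once, at m = x + N. *)
Lemma sum_indic_shift {R : realType} (N : nat) (x : int) (G : R -> R) : (`|x| <= N)%N ->
  \sum_(m < N.*2.+1) (m%:Z - N%:Z == x)%:R * G (m%:R - N%:R) = G x%:~R.
Proof.
move=> xN; have m0_lt : (`|(x + N%:Z)%R| < N.*2.+1)%N by lia.
have m0E : (Ordinal m0_lt)%:Z = x + N%:Z by rewrite /=; lia.
rewrite (bigD1 (Ordinal m0_lt))//= big1 => [|m mm0]; last first.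
  rewrite (_ : (_ == _) = false) ?mul0r//; apply: contra_neqF mm0 => /eqP mE.
  by apply: val_inj => /=; lia.
rewrite -[(Ordinal m0_lt : nat)%:R]/((Ordinal m0_lt)%:Z%:~R) -[N%:R]/(N%:Z%:~R).
by rewrite -intrB m0E addrK eqxx mul1r addr0.
Qed.

(** * The heat semigroup acting on packets *)

Section Heat.
Context {R : realType} (I : finType) (k l : I -> nat).
Implicit Types (C : I -> R) (y z : R).

(** A real sine carries the two opposite frequencies (k, l) and - (k, l), each with half of its
    amplitude; the sign [s] tells which of them (a, b) is. *)
Lemma integralT2_packet_cos C y z (a b : int) :
  integralT2 (fun y' z' => packet k l C (fun=> 0) y' z' *
    cos (2 * pi * (a%:~R * (y - y') + b%:~R * (z - z')))) =
  \sum_i \sum_(s : bool) C i / 2 *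
    ((a == (-1) ^+ s * (k i)%:Z) && (b == (-1) ^+ s * (l i)%:Z))%:R *
    sin (2 * pi * ((k i)%:R * y + (l i)%:R * z)).
Proof.
pose m (p : I * bool) : int := (k p.1)%:Z - (-1) ^+ p.2 * a.
pose n (p : I * bool) : int := (l p.1)%:Z - (-1) ^+ p.2 * b.
pose th (p : I * bool) : R := (-1) ^+ p.2 * (2 * pi * (a%:~R * y + b%:~R * z)).
transitivity (integralT2 (fun y' z' => \sum_(p : I * bool) (C p.1 / 2) *
    sin (2 * pi * ((m p)%:~R * y' + (n p)%:~R * z') + th p))).
  congr integralT2; apply/funext => y'; apply/funext => z'.
  rewrite /packet mulr_suml.
  rewrite -(pair_bigA _ (fun i s => (C i / 2) *
    sin (2 * pi * ((m (i, s))%:~R * y' + (n (i, s))%:~R * z') + th (i, s)))) /=.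
  apply: eq_bigr => i _; rewrite -mulrA sinM_cos_sum_sign mulr_sumr.
  apply: eq_bigr => s _; rewrite mulrA; congr (_ * sin _).
  by rewrite /m /n /th /= !intrB !intrM !rmorphXn /= !rmorphN1 -!pmulrn; ring.
rewrite integralT2_trig.
rewrite -(pair_bigA _ (fun i s => C i / 2 *
    ((m (i, s) == 0) && (n (i, s) == 0))%:R * sin (th (i, s)))) /=.
apply: eq_bigr => i _; apply: eq_bigr => s _; rewrite /m /n /th /=.
have signE (x : int) (c : nat) : (c%:Z - (-1) ^+ s * x == 0) = (x == (-1) ^+ s * c%:Z).
  by rewrite subr_eq0 eq_sym; case: s => /=; rewrite ?expr1 ?expr0 ?mulN1r ?mul1r// eqr_oppLR.
rewrite !signE; case: andP => [[/eqP -> /eqP ->]|_]; last by rewrite !mulr0 !mul0r.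
congr (_ * sin _).
by case: s {signE} => /=; rewrite ?expr1 ?expr0 ?mulN1r ?mul1r ?rmorphN -?pmulrn; ring.
Qed.

Lemma heatT2_packet nu (t : R) C y z :
  heatT2 nu t (packet k l C (fun=> 0)) y z =
  packet k l (fun i => C i *
    expR (- (nu * t * (2 * pi) ^+ 2 * ((k i)%:R ^+ 2 + (l i)%:R ^+ 2)))) (fun=> 0) y z.
Proof.
apply/cvg_lim => //; apply: cvg_near_cst.
(* Beyond this [N] the square of summation contains all frequencies of the packet, so the partial
   sums are constant. *)
exists (\max_i maxn (k i) (l i)) => // N /= maxN.
have kN i : (k i <= N)%N /\ (l i <= N)%N.
  by apply/andP; rewrite -geq_max; apply: leq_trans maxN; exact: leq_bigmax.
pose E (x y : R) := expR (- (nu * t * (2 * pi) ^+ 2 * (x ^+ 2 + y ^+ 2))).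
pose S i := sin (2 * pi * ((k i)%:R * y + (l i)%:R * z)).
transitivity (\sum_i \sum_(s : bool) \sum_(m < N.*2.+1) \sum_(n < N.*2.+1)
   C i / 2 * S i * ((m%:Z - N%:Z == (-1) ^+ s * (k i)%:Z)%:R *
     ((n%:Z - N%:Z == (-1) ^+ s * (l i)%:Z)%:R * E (m%:R - N%:R) (n%:R - N%:R)))).
  under [in RHS]eq_bigr do rewrite exchange_big.
  rewrite [RHS]exchange_big; apply: eq_bigr => m _.
  under [in RHS]eq_bigr do rewrite exchange_big.
  rewrite [RHS]exchange_big; apply: eq_bigr => n _ /=.
  rewrite -[m%:R]/(m%:Z%:~R) -[N%:R]/(N%:Z%:~R) -[n%:R]/(n%:Z%:~R) -!intrB.
  rewrite integralT2_packet_cos mulr_sumr; apply: eq_bigr => i _.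
  rewrite mulr_sumr; apply: eq_bigr => s _.
  by rewrite -mulnb natrM /S /E; ring.
apply: eq_bigr => i _; rewrite addr0 -/(S i).
(* The multiplier is even in each frequency, so the two signs give equal halves. *)
transitivity (\sum_(s : bool) C i / 2 * S i * E (k i)%:R (l i)%:R).
  apply: eq_bigr => s _; have [ki li] := kN i.
  have abs_le c : (c <= N)%N -> (`|((-1) ^+ s * c%:Z)%R| <= N)%N by rewrite abszMsign.
  under eq_bigr do rewrite -mulr_sumr -mulr_sumr.
  under eq_bigr => m _ do
    rewrite (sum_indic_shift (fun x => E (m%:R - N%:R) x) (abs_le _ li)).
  rewrite -mulr_sumr (sum_indic_shift (fun x => E x _) (abs_le _ ki)) /E.
  by rewrite !intrM !rmorphXn /= !rmorphN1 -!pmulrn !exprMn !sqrr_sign !mul1r.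
by rewrite big_bool /= /E; field.
Qed.

End Heat.

(** * Smoothness and the Navier--Stokes equations *)

Section Derivatives.
Context {R : realType} {V : normedModType R}.
Implicit Types (L : V -> R) (dL : V -> R).

Lemma derive_comp1 (h : V -> R) (g : R -> R) (x v : V) (g' : R) :
  is_derive (h x) 1 g g' -> differentiable h x ->
  differentiable (fun y => g (h y)) x /\ 'D_v (fun y => g (h y)) x = g' * 'D_v h x.
Proof.
move=> dg dh; have dg' : differentiable g (h x).
  by apply/derivable1_diffP; exact: (@ex_derive _ _ _ _ _ _ _ dg).
split; first exact: differentiable_comp.
rewrite (deriveE v (differentiable_comp dh dg')) (deriveE v dh) diff_comp//=.
by rewrite (diff1E dg') derive1E (derive_val (is_derive := dg)) [LHS]mulrC.
Qed.

Lemma derive_big_sum (I : Type) (s : seq I) (f : I -> V -> R) (x v : V) :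
  (forall i, differentiable (f i) x) ->
  differentiable (fun y => \sum_(i <- s) f i y) x /\
  'D_v (fun y => \sum_(i <- s) f i y) x = \sum_(i <- s) 'D_v (f i) x.
Proof.
move=> df; elim: s => [|i s [ds Ds]].
  rewrite big_nil (_ : (fun _ => _) = cst 0); last by apply/funext => y; rewrite big_nil.
  by split; [exact: differentiable_cst|exact: derive_cst].
rewrite (_ : (fun _ => _) = f i \+ (fun y => \sum_(i <- s) f i y)); last first.
  by apply/funext => y; rewrite big_cons.
split; first exact: differentiableD.
by rewrite big_cons deriveD ?Ds//; exact: diff_derivable.
Qed.

(** The derivative [dL] does not depend on the point; this keeps the coefficients of a wave constant
    under differentiation. *)
Definition affine L dL :=
  (forall x, differentiable L x) /\ forall x v, 'D_v L x = dL v.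

Lemma affine_cst (c : R) : affine (fun=> c) (fun=> 0).
Proof. by split => x; [exact: differentiable_cst|move=> v; exact: derive_cst]. Qed.

Lemma affineD L1 dL1 L2 dL2 : affine L1 dL1 -> affine L2 dL2 ->
  affine (fun x => L1 x + L2 x) (fun v => dL1 v + dL2 v).
Proof.
move=> [d1 D1] [d2 D2]; split => x; first exact: differentiableD.
by move=> v; rewrite deriveD ?D1 ?D2//; exact: diff_derivable.
Qed.

Lemma affineZ (a : R) L dL : affine L dL -> affine (fun x => a * L x) (fun v => a * dL v).
Proof.
move=> [d1 D1]; split => x; first exact: (differentiableZ a).
by move=> v; rewrite (deriveZ a) ?D1//; exact: diff_derivable.
Qed.

Lemma affine_linear (L : V -> R) : (forall a x y, L (a *: x + y) = a * L x + L y) ->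
  (forall x, differentiable L x) -> affine L L.
Proof.
move=> linL dL; split => // x v; apply: cvg_lim => //; apply: cvg_near_cst.
rewrite near_withinE; near=> h => h0.
by rewrite /= linL addrK /GRing.scale /= mulKf.
Unshelve. all: by end_near. Qed.

(** The cosine is written as a shifted sine, so that the derivative is again a sum of waves. *)
Lemma derive_wave (C : R) L1 dL1 L2 dL2 x v : affine L1 dL1 -> affine L2 dL2 ->
  differentiable (fun p => C * (expR (L1 p) * sin (L2 p))) x /\
  'D_v (fun p => C * (expR (L1 p) * sin (L2 p))) x =
  C * dL1 v * (expR (L1 x) * sin (L2 x)) +
  C * dL2 v * (expR (L1 x) * sin (L2 x + pi / 2)).
Proof.
move=> [d1 D1] [d2 D2].
have [de De] := derive_comp1 v (is_derive_expR (L1 x)) (d1 x).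
have [ds Ds] := derive_comp1 v (is_derive_sin (L2 x)) (d2 x).
have dM := differentiableM de ds.
split; first exact: (differentiableZ C).
rewrite (deriveZ C); last exact: diff_derivable.
rewrite deriveM ?De ?Ds ?D1 ?D2; try exact: diff_derivable.
by rewrite /GRing.scale /= sinDpihalf; ring.
Qed.

(* A class of functions closed under directional derivatives. *)
Inductive wave_sum : (V -> R) -> Prop :=
| wave_sum_wave C L1 dL1 L2 dL2 : affine L1 dL1 -> affine L2 dL2 ->
    wave_sum (fun p => C * (expR (L1 p) * sin (L2 p)))
| wave_sum_add f g : wave_sum f -> wave_sum g -> wave_sum (fun p => f p + g p).

Lemma wave_sum_derive f : wave_sum f ->
  (forall x, differentiable f x) /\ forall v, wave_sum ('D_v f).
Proof.
elim=> {f} [C L1 dL1 L2 dL2 aL1 aL2|f g _ [df Df] _ [dg Dg]].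
  split => [x|v]; first exact: (derive_wave C x 0 aL1 aL2).1.
  rewrite (_ : 'D_v _ = fun x => C * dL1 v * (expR (L1 x) * sin (L2 x)) +
    C * dL2 v * (expR (L1 x) * sin (L2 x + pi / 2))); last first.
    by apply/funext => x; exact: (derive_wave C x v aL1 aL2).2.
  apply: wave_sum_add; first exact: wave_sum_wave aL1 aL2.
  exact: wave_sum_wave aL1 (affineD aL2 (affine_cst _)).
split => [x|v]; first exact: differentiableD.
rewrite (_ : 'D_v _ = fun x => 'D_v f x + 'D_v g x); last first.
  by apply/funext => x; rewrite deriveD//; exact: diff_derivable.
exact: wave_sum_add.
Qed.

Lemma wave_sum0 : wave_sum (fun=> 0).
Proof.
rewrite (_ : (fun=> 0) = (fun p : V => 0 * (expR 0 * sin 0))).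
  exact: (@wave_sum_wave 0 (fun=> 0) _ (fun=> 0) _ (affine_cst 0) (affine_cst 0)).
by apply/funext => p; rewrite mul0r.
Qed.

Lemma wave_sum_sum (I : finType) (f : I -> V -> R) : (forall i, wave_sum (f i)) ->
  wave_sum (fun p => \sum_i f i p).
Proof.
move=> wf; elim: (index_enum I) => [|i s IHs].
  by under eq_fun do rewrite big_nil; exact: wave_sum0.
by under eq_fun do rewrite big_cons; exact: wave_sum_add.
Qed.

Lemma smooth_wave_sum f : wave_sum f -> smooth f.
Proof.
move=> wf vs; have /wave_sum_derive [dvs _] : wave_sum (iter_derive vs f).
  by elim: vs => //= v vs /wave_sum_derive[_]; exact.
split => [x|v x]; first exact: differentiable_continuous.
exact: diff_derivable.
Qed.

End Derivatives.

Section Coordinates.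
Context {R : realType}.

Lemma affine_coord (j : 'I_3) :
  affine (fun x : 'rV[R]_3 => x 0 j) (fun v => v 0 j).
Proof.
apply: affine_linear => [a x y|x]; first by rewrite !mxE.
exact: differentiable_coord.
Qed.

Lemma affine_time : affine (fun p : (R * 'rV[R]_3)%type => p.1) (fun p => p.1).
Proof.
apply: affine_linear => [//|p]; apply: (@linear_differentiable _ _ _ fst).
by move=> q; exact: cvg_fst.
Qed.

Lemma affine_space_coord (j : 'I_3) :
  affine (fun p : (R * 'rV[R]_3)%type => p.2 0 j) (fun p => p.2 0 j).
Proof.
apply: affine_linear => [a x y|p]; first by rewrite !mxE.
apply: (@differentiable_comp _ _ _ _ snd (fun x : 'rV[R]_3 => x 0 j)).
  by apply: (@linear_differentiable _ _ _ snd) => q; exact: cvg_snd.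
exact: differentiable_coord.
Qed.

End Coordinates.

Section ShearPacket.
Context {R : realType} (I : finType) (k l : I -> nat).
Implicit Types (C delta : I -> R) (x v : 'rV[R]_3).

Lemma derive_packet C delta x v :
  differentiable (fun y : 'rV[R]_3 => packet k l C delta (y 0 1) (y 0 2)) x /\
  'D_v (fun y : 'rV[R]_3 => packet k l C delta (y 0 1) (y 0 2)) x =
  packet k l (fun i => C i * (2 * pi * ((k i)%:R * v 0 1 + (l i)%:R * v 0 2)))
    (fun i => delta i + pi / 2) (x 0 1) (x 0 2).
Proof.
pose L i := fun y : 'rV[R]_3 => 2 * pi * ((k i)%:R * y 0 1 + (l i)%:R * y 0 2) + delta i.
have aL i := affineD (affineZ (2 * pi) (affineD (affineZ (k i)%:R (@affine_coord R 1))
  (affineZ (l i)%:R (@affine_coord R 2)))) (affine_cst (delta i)).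
have dw i := derive_wave (C i) x v (@affine_cst R 'rV[R]_3 0) (aL i).
rewrite (_ : (fun y : 'rV[R]_3 => packet _ _ _ _ _ _) =
    fun y => \sum_i C i * (expR 0 * sin (L i y))); last first.
  by apply/funext => y; apply: eq_bigr => i _; rewrite expR0 mul1r.
have [dsum Dsum] := @derive_big_sum R _ _ (index_enum I) _ x v (fun i => (dw i).1).
split; first exact: dsum.
rewrite Dsum; apply: eq_bigr => i _.
by rewrite (dw i).2 mulr0 mul0r add0r addr0 expR0 mul1r addrA.
Qed.

Definition decay (nu : R) (c : R) (t : R) (i : I) : R :=
  c * expR (- (nu * t * (2 * pi) ^+ 2 * ((k i)%:R ^+ 2 + (l i)%:R ^+ 2))).

Definition shear (nu c t : R) (x : 'rV[R]_3) : 'rV[R]_3 :=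
  \row_(j < 3) if j == 0 then packet k l (decay nu c t) (fun=> 0) (x 0 1) (x 0 2)
               else 0.

Lemma smooth_shear nu c (i : 'I_3) : smooth_halfspace (fun t x => shear nu c t x 0 i).
Proof.
(* The closed formula makes sense at negative times and is its own smooth extension. *)
exists (fun p : (R * 'rV[R]_3)%type => shear nu c p.1 p.2 0 i) => //.
apply: smooth_wave_sum; rewrite /shear; under eq_fun do rewrite mxE.
case: (i == 0); last exact: wave_sum0.
apply: wave_sum_sum => j.
pose r := - (nu * (2 * pi) ^+ 2 * ((k j)%:R ^+ 2 + (l j)%:R ^+ 2)).
have := @wave_sum_wave _ _ c _ _ _ _ (affineZ r (@affine_time R))
  (affineD (affineZ (2 * pi) (affineD (affineZ (k j)%:R (@affine_space_coord R 1))
  (affineZ (l j)%:R (@affine_space_coord R 2)))) (affine_cst 0)).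
congr wave_sum; apply/funext => p; rewrite /decay mulrA; congr (_ * expR _ * _).
by rewrite /r; ring.
Qed.

Lemma partial_shear nu c t (i j : 'I_3) x :
  partial j (fun y => shear nu c t y 0 i) x =
  if i == 0 then
    packet k l (fun q => decay nu c t q *
      (2 * pi * ((k q)%:R * (j == 1)%:R + (l q)%:R * (j == 2)%:R)))
      (fun=> 0 + pi / 2) (x 0 1) (x 0 2)
  else 0.
Proof.
rewrite /partial /shear; under eq_fun do rewrite mxE.
case: (i == 0); last exact: derive_cst.
by rewrite (derive_packet _ _ _ _).2 !mxE !eqxx/= ![(_ == j)]eq_sym.
Qed.

Lemma derive1_packet_decay nu c t y z :
  (fun s => packet k l (decay nu c s) (fun=> 0) y z)^`()%classic t =
  packet k l (fun i => - (nu * (2 * pi) ^+ 2 * ((k i)%:R ^+ 2 + (l i)%:R ^+ 2)) *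
    decay nu c t i) (fun=> 0) y z.
Proof.
rewrite derive1E; pose S i := sin (2 * pi * ((k i)%:R * y + (l i)%:R * z) + 0).
have dS i : is_derive t 1 (fun s => decay nu c s i * S i)
    (- (nu * (2 * pi) ^+ 2 * ((k i)%:R ^+ 2 + (l i)%:R ^+ 2)) * decay nu c t i * S i).
  by rewrite /decay; apply: is_derive_eq; rewrite /GRing.scale /=; ring.
have [_ ->] := @derive_big_sum R R _ (index_enum I) _ t 1
  (fun i => (derivable1_diffP _ _).1 (@ex_derive _ _ _ _ _ _ _ (dS i))).
by apply: eq_bigr => i _; exact: derive_val.
Qed.

(** The velocity points along x_1 and is constant in x_1, so divergence and transport vanish and the
    pressure can be 0. The heat equation that remains holds wave by wave, as two derivatives shift
    each phase by pi. *)
Lemma NS_shear nu c : NS_solution nu (shear nu c).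
Proof.
exists (fun _ _ => 0); split.
- split; first exact: smooth_shear.
  by exists (fun=> 0) => //; apply: smooth_wave_sum; exact: wave_sum0.
- move=> t _; split => // x q; apply/rowP => j; rewrite !mxE; case: ifP => // _.
  exact: periodic2_packet.
- move=> t x _; apply: big1 => j _; rewrite partial_shear; case: eqP => // ->.
  by apply: big1 => i _; rewrite /= !(mulr0, addr0, mul0r).
move=> t x i _.
rewrite [X in _ + X](_ : _ = 0) ?addr0; last exact: derive_cst.
rewrite [X in _ + X - _](_ : _ = 0) ?addr0; last first.
  apply: big1 => j _; rewrite partial_shear mxE; case: eqP => [->|_]; last by rewrite mul0r.
  case: eqP => _; last by rewrite mulr0.
  by rewrite [X in _ * X]big1 ?mulr0// => q _; rewrite /= !(mulr0, addr0, mul0r).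
have partialE j : partial j (fun y => shear nu c t y 0 i) =
    fun y => if i == 0 then packet k l (fun q => decay nu c t q *
      (2 * pi * ((k q)%:R * (j == 1)%:R + (l q)%:R * (j == 2)%:R)))
      (fun=> 0 + pi / 2) (y 0 1) (y 0 2) else 0.
  by apply/funext => y; exact: partial_shear.
under eq_bigr do rewrite partialE.

rewrite /shear; under eq_fun do rewrite mxE.
case: (i == 0); last first.
  rewrite big1 ?mulr0 ?subr0 => [|j _]; last exact: derive_cst.
  by rewrite derive1_cst.
rewrite derive1_packet_decay.
under eq_bigr do rewrite /partial (derive_packet _ _ _ _).2.
rewrite !big_ord_recl big_ord0 addr0 !mxE /= /packet.
rewrite -!big_split mulr_sumr -sumrB.
apply: big1 => q _.
have sin_pi (a : R) : sin (a + (0 + pi / 2 + pi / 2)) = - sin a.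
  by rewrite add0r addrA sinDpihalf cosDpihalf.
by rewrite /= !sin_pi addr0; ring.
Qed.

End ShearPacket.

(** * The stochastic flow and its mean deformation *)

Section PacketIntegral.
Context {R : realType} (I : finType) (k l : I -> nat).
Local Notation mu := (@lebesgue_measure R).

(** The addition formula for the sine separates space from time: random phases move into the
    coefficients, while the dependence on (y, z) stays deterministic. *)
Lemma integral_packet (e phi : I -> R -> R) (t y z : R) :
  (forall i, continuous (e i)) -> (forall i, continuous (phi i)) ->
  \int[mu]_(s in `[0, t]) packet k l (e ^~ s) (phi ^~ s) y z =
  packet k l (fun i => \int[mu]_(s in `[0, t]) (e i s * cos (phi i s))) (fun=> 0) y z +
  packet k l (fun i => \int[mu]_(s in `[0, t]) (e i s * sin (phi i s))) (fun=> pi / 2) y z.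
Proof.
move=> ce cphi.
pose L i := 2 * pi * ((k i)%:R * y + (l i)%:R * z).
pose a (p : I * bool) := if p.2 then sin (L p.1) else cos (L p.1).
pose g (p : I * bool) (s : R) := e p.1 s * (if p.2 then cos (phi p.1 s) else sin (phi p.1 s)).
have cg p : continuous (g p).
  case: p => i [] s; apply: cvgM; try exact: ce.
    by apply: continuous_comp; [exact: cphi|exact: continuous_cos].
  by apply: continuous_comp; [exact: cphi|exact: continuous_sin].
transitivity (\int[mu]_(s in `[0, t]) (\sum_p a p * g p s)).
  apply: eq_Rintegral => s _; rewrite /packet.
  rewrite -(pair_bigA _ (fun i b => a (i, b) * g (i, b) s)) /=.
  apply: eq_bigr => i _; rewrite big_bool /a /g /= -/(L i) sinD; ring.
rewrite Rintegral_itv0_sum// -(pair_bigA _ (fun i b => a (i, b) *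
  \int[mu]_(s in `[0, t]) g (i, b) s)) /= -big_split.
apply: eq_bigr => i _; rewrite big_bool /a /g /= -/(L i) addr0 sinDpihalf.
by congr (_ + _); rewrite mulrC.
Qed.

End PacketIntegral.

Lemma integral_linear_combination {R : realType} (d : measure_display)
    (T : measurableType d) (P : {measure set T -> \bar R}) (J : finType)
    (a m : J -> R) (g : J -> T -> R) :
  (forall j, P.-integrable setT (EFin \o g j)) ->
  (forall j, (\int[P]_w (g j w)%:E = (m j)%:E)%E) ->
  P.-integrable setT (EFin \o (fun w => \sum_j a j * g j w)) /\
  (\int[P]_w (\sum_j a j * g j w)%:E = (\sum_j a j * m j)%:E)%E.
Proof.
move=> ig mg; elim: (index_enum J) => [|j s [IHi IHs]].
  rewrite big_nil; split.
    by rewrite /comp; under eq_fun do rewrite big_nil; exact: integrable0.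
  by under eq_integral do rewrite big_nil; rewrite integral0.
have iag : P.-integrable setT (fun w => ((a j)%:E * (g j w)%:E)%E).
  by apply: integrableZl => //; exact: ig.
have E w : (\sum_(i <- j :: s) a i * g i w)%:E =
    ((a j)%:E * (g j w)%:E + (\sum_(i <- s) a i * g i w)%:E)%E.
  by rewrite big_cons EFinD EFinM.
split; first by rewrite /comp; under eq_fun do rewrite E; exact: integrableD.
under eq_integral do rewrite E.
by rewrite integralD// integralZl ?ig// mg IHs big_cons EFinD EFinM.
Qed.

Section Flow.
Context {R : realType} (I : finType) (k l : I -> nat).
Context {d : measure_display} {Omega : measurableType d}.
Local Notation mu := (@lebesgue_measure R).
Variables (P : probability Omega R) (W : R -> Omega -> 'rV[R]_3).
Hypothesis BM : brownian_motion P W.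
Variable V : 'I_3 -> R -> Omega -> R.
Hypothesis mV : forall i t, measurable_fun setT (V i t).
Hypothesis cV : forall i w, continuous (V i ^~ w).
Hypothesis VW : {ae P, forall w, forall i t, 0 <= t -> V i t w = W t w 0 i}.
Variables nu c : R.
Hypothesis nu_gt0 : 0 < nu.

Let sigma := Num.sqrt (2 * nu).
Let e i s := decay k l nu c s i.
Let theta i s w := 2 * pi * ((k i)%:R * (sigma * V 1 s w) + (l i)%:R * (sigma * V 2 s w)).

Let continuous_e i : continuous (e i).
Proof. by apply: derivable1_continuous => s; exact: ex_derive. Qed.

Let e_le i s : 0 <= s -> `|e i s| <= `|c|.
Proof.
move=> s0; rewrite normrM ler_piMr// ger0_norm ?expR_ge0//.
rewrite -[leRHS]expR0 ler_expR oppr_le0 mulr_ge0 ?addr_ge0 ?sqr_ge0//.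
by apply: mulr_ge0 (sqr_ge0 _); exact: mulr_ge0 (ltW nu_gt0) s0.
Qed.

Let measurable_theta i s : measurable_fun setT (theta i s).
Proof.
apply: measurable_funM; first exact: measurable_cst.
by apply: measurable_funD; do 2 (apply: measurable_funM; first exact: measurable_cst); exact: mV.
Qed.

Let continuous_theta i w : continuous (fun s => theta i s w).
Proof.
move=> s; apply: cvgM; first exact: cvg_cst.
by apply: cvgD; apply: cvgM; try exact: cvg_cst; apply: cvgM; try exact: cvg_cst; exact: cV.
Qed.

Let measurable_cos_comp (f : Omega -> R) : measurable_fun setT f ->
  measurable_fun setT (fun w => cos (f w)).
Proof.
move=> mf; apply: measurableT_comp => //.
by apply: continuous_measurable_fun; exact: continuous_cos.
Qed.

Lemma integral_cos_V (a b delta s t : R) : 0 <= s -> s <= t ->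
  (\int[P]_w (cos (a * (V 1 t w - V 1 s w) + b * (V 2 t w - V 2 s w) + delta))%:E)%E =
  (expR (- ((t - s) * (a ^+ 2 + b ^+ 2) / 2)) * cos delta)%:E.
Proof.
move=> s0 st; rewrite -(integral_cos_increment BM _ _ delta s0 st (isT : (1 : 'I_3) != 2)).
have mc (f g : Omega -> R) : measurable_fun setT f -> measurable_fun setT g ->
    measurable_fun setT (fun w => (cos (a * f w + b * g w + delta))%:E).
  move=> mf mg; apply/measurable_EFinP/measurable_cos_comp.
  apply: measurable_funD; last exact: measurable_cst.
  by apply: measurable_funD; apply: measurable_funM => //; exact: measurable_cst.
have [mW _ _ _] := BM; have t0 : 0 <= t by exact: le_trans st.
apply: ae_eq_integral => //.
- by apply: (mc (fun w => _ - _) (fun w => _ - _)); apply: measurable_funB; exact: mV.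
- by apply: (mc (fun w => _ - _) (fun w => _ - _)); apply: measurable_funB; exact: mW.
- case: VW => N [mN PN subN]; exists N; split => // w /= H; apply: subN => /= VWw.
  by apply: H => _; rewrite !VWw.
Qed.

Section wave.
Variables (Phi : R -> Omega -> R) (i : I) (t : R).
Hypothesis mPhi : forall s, measurable_fun setT (Phi s).
Hypothesis cPhi : forall w, continuous (Phi ^~ w).

Let h s w := e i s * cos (Phi s w).

Let mh : measurable_fun setT (fun p : measurableTypeR R * Omega => h p.1 p.2).
Proof.
apply: measurable_fun_continuous_path => [s|w s].
  by apply: measurable_funM => //; exact: measurable_cos_comp.
by apply: cvgM; [exact: continuous_e|apply: continuous_comp; [exact: cPhi|exact: continuous_cos]].
Qed.

Let h_le s w : 0 <= s <= t -> `|h s w| <= `|c|.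
Proof.
move=> /andP[s0 _]; rewrite normrM -[leRHS]mulr1.
by apply: ler_pM => //; [exact: e_le|exact: cos_max].
Qed.

Lemma measurable_wave_integral :
  measurable_fun setT (fun w => \int[mu]_(s in `[0, t]) (e i s * cos (Phi s w))).
Proof. exact: (measurable_path_integral P (normr_ge0 c) mh h_le). Qed.

Lemma integrable_wave_integral : 0 <= t -> P.-integrable setT
  (EFin \o (fun w => \int[mu]_(s in `[0, t]) (e i s * cos (Phi s w)))).
Proof.
move=> t0; have ic : mu.-integrable `[0, t] (EFin \o (fun=> `|c|)).
  by apply: integrable_continuous_itv0; exact: cst_continuous.
apply: (@integrable_bounded _ _ _ _ _ (\int[mu]_(s in `[0, t]) `|c|)).
  exact: measurable_wave_integral.
move=> w; have ih : mu.-integrable `[0, t] (EFin \o (fun s => e i s * cos (Phi s w))).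
  apply: integrable_continuous_itv0 => s; apply: cvgM; first exact: continuous_e.
  by apply: continuous_comp; [exact: cPhi|exact: continuous_cos].
apply: (le_trans (le_normr_Rintegral _ ih)) => //.
apply: le_Rintegral => //; first exact: integrable_norm.
by move=> s; rewrite /= in_itv; exact: h_le.
Qed.

Lemma integral_wave_integral (m : R) : 0 <= t ->
  (forall s, 0 <= s <= t -> (\int[P]_w (e i s * cos (Phi s w))%:E = m%:E)%E) ->
  (\int[P]_w (\int[mu]_(s in `[0, t]) (e i s * cos (Phi s w)))%:E = (t * m)%:E)%E.
Proof.
move=> t0 hm.
rewrite (integral_path_integral (normr_ge0 c) mh h_le (@cst_continuous _ _ m) hm).
rewrite Rintegral_cst//= lebesgue_measure_itv/= lte_fin.
have [_|t_le0] := ltP 0 t; first by rewrite /= oppr0 addr0 mulrC.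
by have -> : t = 0 by [apply/le_anti/andP]; rewrite mulr0 mul0r.
Qed.

End wave.

(* The phase seen from [X_t = x]: [theta i s w - theta i t w]; the shift [delta]
   is 0 for cosines and - pi / 2 for sines. *)
Let backward i t delta s w := theta i s w - theta i t w + delta.

Let measurable_backward i t delta s : measurable_fun setT (backward i t delta s).
Proof. by apply: measurable_funD => //; exact: measurable_funB. Qed.

Let continuous_backward i t delta w : continuous (backward i t delta ^~ w).
Proof.
by move=> s; do 2 (apply: cvgD; last exact: cvg_cst); exact: continuous_theta.
Qed.

(* The heat decay on [0, s] of the velocity and the Gaussian decay on [s, t] of
   the increment combine to the decay on [0, t], whatever s is. *)
Lemma integral_backward_wave i t delta : 0 <= t ->
  (\int[P]_w (\int[mu]_(s in `[0, t]) (e i s * cos (backward i t delta s w)))%:E =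
   (t * (e i t * cos delta))%:E)%E.
Proof.
move=> t0; apply: integral_wave_integral => // s /andP[s0 st].
(* The signs are negative because [backward] contains theta at s minus theta at t; they disappear in
   the squares. *)
pose a := - (2 * pi * (k i)%:R * sigma); pose b := - (2 * pi * (l i)%:R * sigma).
transitivity (\int[P]_w ((e i s)%:E *
    (cos (a * (V 1 t w - V 1 s w) + b * (V 2 t w - V 2 s w) + delta))%:E))%E.
  apply: eq_integral => w _; rewrite -EFinM; congr ((_ * cos _)%:E).
  by rewrite /backward /theta /a /b; ring.
rewrite integralZl//; last first.
  apply: (@integrable_bounded _ _ _ _ _ 1) => [|w]; last exact: cos_max.
  apply: measurable_cos_comp; apply: measurable_funD; last exact: measurable_cst.
  by apply: measurable_funD; apply: measurable_funM; try exact: measurable_cst;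
    apply: measurable_funB; exact: mV.
rewrite integral_cos_V// -EFinM mulrA /e /decay.
congr ((_ * cos delta)%:E); rewrite -[LHS]mulrA. rewrite -expRD; congr (c * expR _).
(* The noise intensity matches the viscosity: the Gaussian exponent is exactly the heat exponent
   over a duration t - s. *)
have sigma2 : sigma ^+ 2 = 2 * nu by rewrite sqr_sqrtr// mulr_ge0// ltW.
by rewrite /a /b !sqrrN !exprMn sigma2; field.
Qed.

(** The second and third coordinates of the flow are the label plus scaled noise, so the
    displacement along x_1 is this explicit integral and no differential equation has to be
    solved. *)
Let drift t w y z := \int[mu]_(s in `[0, t])
  packet k l (decay k l nu c s) (fun=> 0) (y + sigma * V 1 s w) (z + sigma * V 2 s w).

Let Jc t w i := \int[mu]_(s in `[0, t]) (e i s * cos (backward i t 0 s w)).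
Let Js t w i := \int[mu]_(s in `[0, t]) (e i s * cos (backward i t (- (pi / 2)) s w)).

Let Kc t w i := \int[mu]_(s in `[0, t]) (e i s * cos (theta i s w)).
Let Ks t w i := \int[mu]_(s in `[0, t]) (e i s * cos (theta i s w - pi / 2)).

(** Expansion from a fixed label, from which measurability in [w] is read off. *)
Let drift_forward t w y z : drift t w y z =
  packet k l (Kc t w) (fun=> 0) y z + packet k l (Ks t w) (fun=> pi / 2) y z.
Proof.
transitivity (\int[mu]_(s in `[0, t]) packet k l (e ^~ s) (fun i => theta i s w) y z).
  by apply: eq_Rintegral => s _; apply: eq_bigr => i _; congr (_ * sin _); rewrite /theta; ring.
rewrite integral_packet//; congr (_ + packet _ _ _ _ _ _).
by apply/funext => i; apply: eq_Rintegral => s _; rewrite cosBpihalf.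
Qed.

(** Expansion from a fixed endpoint (y, z), the form that is differentiated to get the gradient of
    [A]. *)
Let drift_backward t w y z :
  drift t w (y - sigma * V 1 t w) (z - sigma * V 2 t w) =
  packet k l (Jc t w) (fun=> 0) y z + packet k l (Js t w) (fun=> pi / 2) y z.
Proof.
have cb i : continuous (fun s => theta i s w - theta i t w).
  by move=> s; apply: cvgB; [exact: continuous_theta|exact: cvg_cst].
transitivity (\int[mu]_(s in `[0, t])
    packet k l (e ^~ s) (fun i => theta i s w - theta i t w) y z).
  by apply: eq_Rintegral => s _; apply: eq_bigr => i _; congr (_ * sin _); rewrite /theta; ring.
rewrite integral_packet//; congr (_ + _); apply: eq_bigr => i _; congr (_ * _);
  apply: eq_Rintegral => s _.
  by rewrite /backward addr0.
by rewrite /backward cosBpihalf.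
Qed.

Let measurable_drift t y z : measurable_fun setT (fun w => drift t w y z).
Proof.
under eq_fun do rewrite drift_forward /packet.
apply: measurable_funD; apply: measurable_sum => i;
  (apply: measurable_funM; last exact: measurable_cst); apply: measurable_wave_integral => //.
  move=> s; apply: measurable_funB => //; exact: measurable_cst.
by move=> w s; apply: cvgB; [exact: continuous_theta|exact: cvg_cst].
Qed.

Let X t w (a : 'rV[R]_3) : 'rV[R]_3 :=
  \row_j (a 0 j + (if j == 0 then drift t w (a 0 1) (a 0 2) else 0) + sigma * V j t w).

(** Undoing the translations in x_2 and x_3 recovers the transverse label, at which the drift to be
    subtracted is evaluated. *)
Let A t w (x : 'rV[R]_3) : 'rV[R]_3 :=
  \row_j (x 0 j - (if j == 0 then
      drift t w (x 0 1 - sigma * V 1 t w) (x 0 2 - sigma * V 2 t w) else 0)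
    - sigma * V j t w).

Let CI_flow_X : CI_flow P W nu (shear k l nu c) X.
Proof.
split=> [t a i t0|].
  under eq_fun do rewrite mxE.
  apply: measurable_funD; last first.
    by apply: measurable_funM; [exact: measurable_cst|exact: mV].
  apply: measurable_funD; first exact: measurable_cst.
  by case: (i == 0); [exact: measurable_drift|exact: measurable_cst].
case: VW => N [mN PN subN]; exists N; split => // w H; apply: subN => VWw; apply: H => a i.
split=> [|t t0].
  have -> : (fun t => X t w a 0 i) = fun t =>
      a 0 i + (if i == 0 then drift t w (a 0 1) (a 0 2) else 0) + sigma * V i t w.
    by apply/funext => t; rewrite mxE.
  have cdrift : {within `[0, +oo[, continuous (fun t => drift t w (a 0 1) (a 0 2))}.
    apply: continuous_integral_itv0.
    apply: continuous_big_sum => q s; apply: cvgM; first exact: continuous_e.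
    apply: continuous_comp; last exact: continuous_sin.
    apply: cvgD; last exact: cvg_cst.
    apply: cvgM; first exact: cvg_cst.
    by apply: cvgD; apply: cvgM; try exact: cvg_cst; apply: cvgD; try exact: cvg_cst;
      apply: cvgM; try exact: cvg_cst; exact: cV.
  move=> t; apply: cvgD.
    apply: cvgD; first exact: cvg_cst.
    by case: (i == 0); [exact: cdrift|exact: cvg_cst].
  apply: cvgM; first exact: cvg_cst.
  exact: (continuous_subspaceT (@cV i w)).
rewrite /X mxE -VWw//; congr (_ + _ + _).
case: ifPn => [/eqP ->|i0]; last first.
  rewrite -[LHS](mul0r (fine (mu `[0%R, t]%classic))) -Rintegral_cst//.
  by apply: eq_Rintegral => s _; rewrite mxE (negbTE i0).
apply: eq_Rintegral => s _; rewrite mxE eqxx !mxE /=.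
by rewrite !addr0.
Qed.

Let freq (j : 'I_3) q : R := 2 * pi * ((k q)%:R * (j == 1)%:R + (l q)%:R * (j == 2)%:R).

Let A_eq t w x i : A t w x 0 i = x 0 i - (if i == 0 then
   packet k l (Jc t w) (fun=> 0) (x 0 1) (x 0 2) +
   packet k l (Js t w) (fun=> pi / 2) (x 0 1) (x 0 2) else 0) - sigma * V i t w.
Proof. by rewrite mxE -drift_backward. Qed.

Let derive_A t w x (i : 'I_3) (v : 'rV[R]_3) :
  differentiable (fun y => A t w y 0 i) x /\
  'D_v (fun y => A t w y 0 i) x = v 0 i - (if i == 0 then
   packet k l (fun q => Jc t w q * (2 * pi * ((k q)%:R * v 0 1 + (l q)%:R * v 0 2)))
     (fun=> 0 + pi / 2) (x 0 1) (x 0 2) +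
   packet k l (fun q => Js t w q * (2 * pi * ((k q)%:R * v 0 1 + (l q)%:R * v 0 2)))
     (fun=> pi / 2 + pi / 2) (x 0 1) (x 0 2) else 0).
Proof.
under eq_fun do rewrite A_eq.
have [dx Dx] := @affine_coord R i.
have [dc Dc] := derive_packet k l (Jc t w) (fun=> 0) x v.
have [ds Ds] := derive_packet k l (Js t w) (fun=> pi / 2) x v.
case: (i == 0).
  have dcs := differentiableD dc ds; have dm := differentiableB (dx x) dcs.
  split; first exact: differentiableB dm (differentiable_cst _ _).
  rewrite deriveB ?derive_cst ?subr0; [|exact: diff_derivable|exact: derivable_cst].
  rewrite deriveB ?Dx; [|exact: diff_derivable|exact: diff_derivable].
  by rewrite deriveD ?Dc ?Ds//; exact: diff_derivable.
under eq_fun do rewrite subr0.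
rewrite subr0; split; first exact: differentiableB (dx x) (differentiable_cst _ _).
by rewrite deriveB ?derive_cst ?subr0 ?Dx//; exact: diff_derivable.
Qed.

Let differentiable_A t w x : differentiable (A t w) x.
Proof.
pose g (y : 'rV[R]_3) := packet k l (Jc t w) (fun=> 0) (y 0 1) (y 0 2) +
  packet k l (Js t w) (fun=> pi / 2) (y 0 1) (y 0 2).
(* Total differentiability of the vector map is required, beyond directional derivatives of its
   entries. *)
have -> : A t w = fun y : 'rV[R]_3 =>
    y - g y *: delta_mx 0 0 - \row_i (sigma * V i t w).
  apply/funext => y; apply/rowP => i; rewrite A_eq !mxE eqxx/=.
  by case: (i == 0); rewrite ?mulr1 ?mulr0.
have dg : differentiable g x.
  by apply: differentiableD; exact: (derive_packet _ _ _ _ _ 0).1.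
have did : differentiable (fun y : 'rV[R]_3 => y) x by exact: ex_diff.
exact: differentiableB (differentiableB did (differentiableZl _ dg)) (differentiable_cst _ _).
Qed.

Let inverse_flow_XA : inverse_flow P X A.
Proof.
apply: aeW => w t t0; split => [a|x|x]; last exact: differentiable_A.
- apply/rowP => i; rewrite [LHS]mxE !mxE /= !addr0 addrK.
  by case: (i == 0); rewrite ?addrK// ?addr0 ?subr0; ring.
- apply/rowP => i; rewrite [LHS]mxE !mxE /= !subr0.
  by case: (i == 0); ring.
Qed.

Let grad_A t w x i j : grad (A t w) x i j = (i == j)%:R - (if i == 0 then
   packet k l (fun q => Jc t w q * freq j q) (fun=> 0 + pi / 2) (x 0 1) (x 0 2) +
   packet k l (fun q => Js t w q * freq j q) (fun=> pi / 2 + pi / 2) (x 0 1) (x 0 2)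
   else 0).
Proof.
have dA := differentiable_A t w x.
have -> : grad (A t w) x i j = ('D_(delta_mx 0 j) (A t w) x) 0 i.
  by rewrite deriveEjacobian// -rowE !mxE.
rewrite derive_mx; last exact: diff_derivable.
by rewrite mxE (derive_A t w x i _).2 !mxE !eqxx/= ![(_ == j)]eq_sym (eq_sym i).
Qed.

(** A formula free of the probability space, since one [M] has to serve every Brownian motion; the
    phase pi / 2 produces the cosines of the gradient. *)
Definition shear_mean_gradient t (x : 'rV[R]_3) : 'M[R]_3 :=
  \matrix_(i, j) ((i == j)%:R - (if i == 0 then
    packet k l (fun q => t * decay k l nu c t q *
      (2 * pi * ((k q)%:R * (j == 1)%:R + (l q)%:R * (j == 2)%:R)))
      (fun=> pi / 2) (x 0 1) (x 0 2)
    else 0)).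

Let mean_gradient_A : mean_gradient P A shear_mean_gradient.
Proof.
move=> t x i j t0.
have -> : (fun w => grad (A t w) x i j) = (fun w => (i == j)%:R - (if i == 0 then
   packet k l (fun q => Jc t w q * freq j q) (fun=> 0 + pi / 2) (x 0 1) (x 0 2) +
   packet k l (fun q => Js t w q * freq j q) (fun=> pi / 2 + pi / 2) (x 0 1) (x 0 2)
   else 0)) by apply/funext => w; exact: grad_A.
have int_cst (r : R) : (\int[P]_w r%:E = r%:E)%E.
  rewrite integral_cst// -[RHS]mule1.
  by congr (_ * _)%E; exact: probability_setT.
have icst (r : R) : P.-integrable setT (EFin \o (fun=> r)).
  by apply: (@integrable_bounded _ _ _ _ _ `|r|) => //; exact: measurable_cst.
rewrite mxE; case: (i == 0); last first.
  by split; [exact: (icst ((i == j)%:R - 0))|rewrite unlock int_cst].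
pose del (b : bool) : R := if b then - (pi / 2) else 0.
pose g (p : I * bool) w := \int[mu]_(s in `[0, t])
  (e p.1 s * cos (backward p.1 t (del p.2) s w)).
(* For [p.2 = true] this is 0, as cos (- pi / 2) = 0: only the [Jc] packet survives averaging. *)
pose m (p : I * bool) : R := t * (e p.1 t * cos (del p.2)).
pose a (p : I * bool) : R := freq j p.1 *
  sin (2 * pi * ((k p.1)%:R * x 0 1 + (l p.1)%:R * x 0 2) +
    ((if p.2 then pi / 2 else 0) + pi / 2)).
have ig p : P.-integrable setT (EFin \o g p) by exact: integrable_wave_integral.
have mg p : (\int[P]_w (g p w)%:E = (m p)%:E)%E by exact: integral_backward_wave.
have [iS mS] := integral_linear_combination a ig mg.
have SE : (fun w => packet k l (fun q => Jc t w q * freq j q) (fun=> 0 + pi / 2) (x 0 1) (x 0 2) +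
   packet k l (fun q => Js t w q * freq j q) (fun=> pi / 2 + pi / 2) (x 0 1) (x 0 2)) =
   fun w => \sum_p a p * g p w.
  apply/funext => w; rewrite -(pair_bigA _ (fun q b => a (q, b) * g (q, b) w)) /= -big_split.
  by apply: eq_bigr => q _; rewrite big_bool /a /g /del /Jc /Js /=; ring.
have SBE : (fun w => (i == j)%:R - (packet k l (fun q => Jc t w q * freq j q)
    (fun=> 0 + pi / 2) (x 0 1) (x 0 2) + packet k l (fun q => Js t w q * freq j q)
    (fun=> pi / 2 + pi / 2) (x 0 1) (x 0 2))) =
  fun w => (i == j)%:R - \sum_p a p * g p w.
  by apply/funext => w; rewrite -[X in _ = _ - X]/((fun w => \sum_p a p * g p w) w) -SE.
rewrite SBE; split; first exact: (integrableB measurableT (icst _) iS).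
rewrite unlock; under eq_integral do rewrite EFinB.
rewrite integralB// ?mS ?int_cst; last exact: icst.
rewrite -EFinB; congr (_ - _)%:E.
rewrite -(pair_bigA _ (fun q b => a (q, b) * m (q, b))) /=.
apply: eq_bigr => q _; rewrite big_bool /a /m /del /= cosN cos_pihalf cos0.
by rewrite add0r /freq /e; ring.
Qed.

Lemma mean_deformation_shear : mean_deformation P W nu (shear k l nu c) shear_mean_gradient.
Proof. by exists X, A; split. Qed.

End Flow.

(** * Blow-up of the Hoelder norm *)

Section Norms.
Context {R : realType}.

Lemma normr_le_enorm m n (v : 'M[R]_(m, n)) i j : `|v i j| <= enorm v.
Proof.
rewrite /enorm -sqrtr_sqr ler_wsqrtr// (bigD1 i)//= (bigD1 j)//= -addrA lerDl.
by rewrite addr_ge0// ?sumr_ge0// => *; rewrite ?sumr_ge0// => *; exact: sqr_ge0.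
Qed.

Lemma normr_le_opnorm n (B : 'M[R]_n) i j : `|B i j| <= opnorm B.
Proof.
have e1 : enorm (delta_mx j 0 : 'cV[R]_n) <= 1.
  rewrite /enorm -[leRHS]sqrtr1 ler_wsqrtr// (bigD1 j)//= big_ord1 mxE !eqxx expr1n.
  by rewrite big1 ?addr0// => q qj; rewrite big_ord1 mxE (negbTE qj)/= expr0n.
pose v0 : 'cV[R]_n := delta_mx j 0.
have -> : B i j = (B *m v0) i 0 by rewrite -colE mxE.
apply: le_trans (normr_le_enorm _ i 0) _.
apply: sup_upper_bound; last by exists v0.
split; first by exists (enorm (B *m v0)), v0.
(* An upper bound is needed for [sup] to dominate its elements; absolute row sums give one, since
   each entry of [v] is at most 1 in absolute value. *)
exists (Num.sqrt (\sum_q \sum_(p < 1) (\sum_s `|B q s|) ^+ 2)) => _ [v v1 <-].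
rewrite /enorm ler_wsqrtr//; apply: ler_sum => q _; apply: ler_sum => p _.
rewrite -[leLHS]real_normK ?num_real// lerXn2r ?nnegrE ?sumr_ge0//.
rewrite mxE (le_trans (ler_norm_sum _ _ _))//; apply: ler_sum => s _.
by rewrite normrM ler_piMr// (le_trans (normr_le_enorm _ _ _)).
Qed.

(** No lattice translate comes closer, because |h + q| >= h for every integer q when h <= 1/2. *)
Lemma torus_dist_shift (h : R) : 0 < h <= 2^-1 ->
  torus_dist (h *: delta_mx 0 1) 0 = h.
Proof.
move=> /andP[h0 h2]; apply/eqP; rewrite eq_le; apply/andP; split.
  apply: ge_inf; first by exists 0 => _ [q _ <-]; exact: sqrtr_ge0.
  exists 0 => //; rewrite subr0 (_ : map_mx _ 0 = 0); last first.
    by apply/matrixP => i j; rewrite !mxE.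
  rewrite addr0 /enorm big_ord1 (bigD1 1)//= big1 => [|j j1]; last first.
    by rewrite !mxE (negbTE j1) mulr0 expr0n.
  by rewrite !mxE !eqxx mulr1 addr0 sqrtr_sqr gtr0_norm.
apply: lb_le_inf.
  by exists (enorm (h *: (delta_mx 0 1 : 'rV[R]_3) - 0 + map_mx intr (0 : 'rV[int]_3))), 0.
move=> _ [q _ <-]; apply: le_trans (normr_le_enorm _ 0 1).
rewrite !mxE !eqxx mulr1 subr0.
have [q0|q0] := leP 0 (q 0 1).
  have : (0 : R) <= (q 0 1)%:~R by rewrite ler0z.
  by move=> ?; rewrite ger0_norm ?addr_ge0 ?(ltW h0)// lerDl.
have : (q 0 1)%:~R <= - (1 : R) by rewrite -(intrN _ 1) ler_int; lia.
move=> q1; rewrite ler0_norm; lra.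
Qed.

Lemma le_Calpha_norm (alpha : R) (B : 'rV[R]_3 -> 'M[R]_3) (x y : 'rV[R]_3) i j :
  0 < torus_dist x y ->
  ((`|B x i j - B y i j| / torus_dist x y `^ alpha)%:E <= Calpha_norm alpha B)%E.
Proof.
move=> d0; rewrite /Calpha_norm -[leLHS]add0e; apply: leeD.
  apply: (@le_trans _ _ (opnorm (B 0))%:E).
    by rewrite lee_fin (le_trans _ (normr_le_opnorm _ 0 0)).
  by apply: ereal_sup_ubound; exists 0.
apply: (@le_trans _ _ (opnorm (B x - B y) / torus_dist x y `^ alpha)%:E).
  rewrite lee_fin ler_wpM2r ?invr_ge0 ?powR_ge0//.
  by have := normr_le_opnorm (B x - B y) i j; rewrite !mxE.
by apply: ereal_sup_ubound; exists (x, y).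
Qed.

End Norms.

Lemma cvg_powR_blowup {R : realType} (alpha kappa : R) (F : R -> \bar R) :
  0 < alpha -> 0 < kappa ->
  (forall r, 0 < r < 1 -> ((kappa / r `^ alpha)%:E <= F r)%E) ->
  F r @[r --> 0^'+] --> +oo%E.
Proof.
move=> a0 k0 FF; apply/cvgeyPge => A.
(* With a positive threshold, kappa / r^alpha >= A' can be solved for r, which gives [del]. *)
pose A' := Num.max A 1; have A'0 : 0 < A' by rewrite lt_max ltr01 orbT.
pose del := (kappa / A') `^ alpha^-1.
have del0 : 0 < del by apply: powR_gt0; exact: divr_gt0.
near=> r.
have r0 : 0 < r by near: r; exact: nbhs_right_gt.
have r1 : r < 1 by near: r; exact: nbhs_right_lt.
have rdel : r < del by near: r; exact: nbhs_right_lt.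
apply: le_trans (FF r _); last by rewrite r0.
rewrite lee_fin; apply: (@le_trans _ _ A'); first by rewrite le_max lexx.
rewrite ler_pdivlMr ?powR_gt0// mulrC -ler_pdivlMr//.
have -> : kappa / A' = del `^ alpha.
  by rewrite /del -powRrM mulVf ?gt_eqF// powRr1// ltW// divr_gt0.
by apply: ge0_ler_powR; rewrite ?nnegrE ltW.
Unshelve. all: by end_near. Qed.

Section Concentration.
Context {R : realType} (N : nat).
Hypothesis N_gt0 : (0 < N)%N.

(* The wave numbers range over (N, 2N]; thus at [h = 1 / (4 N)] all the phases
   [2 pi k h] lie in (pi / 2, pi], where the cosine is nonpositive. *)
Definition wave_k (p : 'I_N * 'I_N) : nat := (N + p.1).+1.
Definition wave_l (p : 'I_N * 'I_N) : nat := (N + p.2).+1.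
(** Each of the N^2 waves then has energy 1 / N^2. *)
Definition amplitude : R := Num.sqrt 2 / N%:R.

Lemma wave_inj : injective (fun p => (wave_k p, wave_l p)).
Proof.
move=> [i j] [i' j'] [] /= ii jj; congr (_, _); apply: val_inj => /=; lia.
Qed.

Lemma packet_unit_energy :
  \sum_(p : 'I_N * 'I_N) amplitude ^+ 2 / 2 = 1.
Proof.
have N0 : (N%:R : R) != 0 by rewrite pnatr_eq0 -lt0n.
rewrite sumr_const card_prod card_ord -[LHS]mulr_natr natrM /amplitude exprMn sqr_sqrtr//.
by field.
Qed.

(** The prefactor is N^2 * N^-2 * (sqrt 2 / N) * (2 pi N): number of waves, time, amplitude, least
    frequency. The exponent is the worst heat decay at time N^-2, from k^2 + l^2 <= 8 N^2. *)
Definition increment_bound (nu : R) : R :=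
  2 * pi * Num.sqrt 2 * expR (- (32 * pi ^+ 2 * nu)).

Lemma mean_gradient_increment (nu : R) : 0 < nu ->
  increment_bound nu <=
  `|shear_mean_gradient wave_k wave_l nu amplitude (N%:R ^- 2)
      ((4 * N%:R)^-1 *: delta_mx 0 1) 0 1
    - shear_mean_gradient wave_k wave_l nu amplitude (N%:R ^- 2) 0 0 1|.
Proof.
move=> nu0; rewrite /increment_bound.
set t := N%:R ^- 2; set kappa := _ * expR _.
have N0 : 0 < N%:R :> R by rewrite ltr0n.
have pi0 := @pi_gt0 R; have s20 : 0 < Num.sqrt 2 :> R by rewrite sqrtr_gt0.
pose h : R := (4 * N%:R)^-1.
pose co p := t * decay wave_k wave_l nu amplitude t p * (2 * pi * (wave_k p)%:R).
have kN p : N%:R <= (wave_k p)%:R :> R /\ (wave_k p)%:R <= 2 * N%:R :> R.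
  by rewrite -natrM !ler_nat /wave_k; have := ltn_ord p.1; lia.
have lN p : N%:R <= (wave_l p)%:R :> R /\ (wave_l p)%:R <= 2 * N%:R :> R.
  by rewrite -natrM !ler_nat /wave_l; have := ltn_ord p.2; lia.
have -> : shear_mean_gradient wave_k wave_l nu amplitude t (h *: delta_mx 0 1) 0 1
     - shear_mean_gradient wave_k wave_l nu amplitude t 0 0 1 =
   \sum_p co p * (1 - cos (2 * pi * ((wave_k p)%:R * h))).
  rewrite !mxE !eqxx /= /packet !sub0r opprK addrC -sumrB; apply: eq_bigr => p _.
  rewrite !mulr0 !mulr1 !addr0 !mulr0 add0r sinDpihalf sin_pihalf /co.
  by ring.
have co_ge p : kappa / N%:R ^+ 2 <= co p.
  have [k1 k2] := kN p; have [l1 l2] := lN p.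
  have -> : kappa / N%:R ^+ 2 = t * (amplitude * expR (- (32 * pi ^+ 2 * nu))) * (2 * pi * N%:R).
    by rewrite /kappa /t /amplitude; field; rewrite gt_eqF.
  have t0 : 0 < t by rewrite invr_gt0 exprn_gt0.
  have amp0 : 0 < amplitude by rewrite divr_gt0.
  have exp_le : expR (- (32 * pi ^+ 2 * nu)) <=
      expR (- (nu * t * (2 * pi) ^+ 2 * ((wave_k p)%:R ^+ 2 + (wave_l p)%:R ^+ 2))).
    rewrite ler_expR lerN2.
    have -> : 32 * pi ^+ 2 * nu = nu * t * (2 * pi) ^+ 2 * (8 * N%:R ^+ 2).
      by rewrite /t; field; rewrite gt_eqF.
    apply: ler_wpM2l; first by rewrite !mulr_ge0// ltW.
    have kk : (wave_k p)%:R ^+ 2 <= (2 * N%:R) ^+ 2 :> R by rewrite lerXn2r ?nnegrE ?mulr_ge0.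
    have ll : (wave_l p)%:R ^+ 2 <= (2 * N%:R) ^+ 2 :> R by rewrite lerXn2r ?nnegrE ?mulr_ge0.
    by apply: (le_trans (lerD kk ll)); rewrite le_eqVlt; apply/orP; left; apply/eqP; ring.
  apply: ler_pM; rewrite ?mulr_ge0 ?expR_ge0 ?(ltW pi0) ?(ltW t0) ?(ltW amp0)//.
    by rewrite ler_wpM2l ?(ltW t0)// ler_wpM2l ?(ltW amp0).
  by rewrite ler_wpM2l// mulr_ge0// ltW.
have cos_le0 p : cos (2 * pi * ((wave_k p)%:R * h)) <= 0.
  (* The phase is pi * k / (2 N) with k / (2 N) in [1/2, 1]; shifted by - pi it lies in
     [- pi / 2, 0], where the cosine is nonnegative. *)
  rewrite -oppr_ge0 -cosDpi.
  have -> : 2 * pi * ((wave_k p)%:R * h) + pi =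
      (2 * pi * ((wave_k p)%:R * h) - pi) + pi *+ 2 :> R.
    by rewrite mulr2n; ring.
  rewrite cosD2pi cos_ge0_pihalf//.
  have [k1 k2] := kN p; rewrite /h.
  have -> : 2 * pi * ((wave_k p)%:R * (4 * N%:R)^-1) =
      pi * ((wave_k p)%:R / (2 * N%:R)) :> R.
    by field; rewrite gt_eqF.
  have q1 : 2^-1 <= (wave_k p)%:R / (2 * N%:R) :> R.
    by rewrite ler_pdivlMr ?mulr_gt0// mulrA mulVf ?mul1r.
  have q2 : (wave_k p)%:R / (2 * N%:R) <= 1 :> R.
    by rewrite ler_pdivrMr ?mulr_gt0// mul1r.
  by nra.
apply: le_trans (ler_norm _).
apply: (@le_trans _ _ (\sum_(p : 'I_N * 'I_N) kappa / N%:R ^+ 2)).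
  rewrite sumr_const card_prod card_ord -[leRHS]mulr_natr natrM.
  by rewrite -expr2 divfK// expf_neq0// gt_eqF.
apply: ler_sum => p _; apply: le_trans (co_ge p) _.
have kappa0 : 0 < kappa by rewrite !mulr_gt0 ?expR_gt0.
have co0 : 0 < co p by apply: lt_le_trans (co_ge p); rewrite divr_gt0 ?exprn_gt0.
(* At the origin each cosine is 1 and at distance h it is at most 0, so no term loses any of its
   coefficient. *)
by rewrite -[leLHS]mulr1 ler_pM2l// lerBrDr gerDl.
Qed.

End Concentration.

Lemma shear_solution_concentrated {R : realType} (nu : R) (N : nat) : (0 < N)%N ->
  shear_solution nu (shear (@wave_k N) (@wave_l N) nu (amplitude N)) /\
  L2norm (shear (@wave_k N) (@wave_l N) nu (amplitude N) 0) = 1.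
Proof.
move=> N0; set f0 := packet (@wave_k N) (@wave_l N) (fun=> amplitude N) (fun=> 0) : R -> R -> R.
have decay0 : decay (@wave_k N) (@wave_l N) nu (amplitude N) 0 = fun=> amplitude N.
  by apply/funext => p; rewrite /decay mulr0 !mul0r oppr0 expR0 mulr1.
split.
  split; first exact: NS_shear.
  exists f0; split.
  - exact: periodic2_packet.
  - exact: integralT2_packet.
  - by move=> t x _; apply/rowP => j; rewrite !mxE heatT2_packet.
  - by move=> x; apply/rowP => j; rewrite !mxE decay0.
rewrite (L2norm_shear (packet _ _ _ _)) decay0 integralT2_packet_sqr //; last exact: wave_inj.
by rewrite packet_unit_energy ?sqrtr1.
Qed.

Theorem proposition6p4 (R : realType) (nu alpha : R)
    (nu_gt0 : 0 < nu) (alpha_gt0 : 0 < alpha) (alpha_lt1 : alpha < 1) :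
  exists (r0 : R) (u : R -> R -> 'rV[R]_3 -> 'rV[R]_3)
         (M : R -> R -> 'rV[R]_3 -> 'M[R]_3),
    [/\ 0 < r0,
        (forall r, 0 < r < r0 ->
           shear_solution nu (u r) /\ L2norm (u r 0) = 1),
        (forall r, 0 < r < r0 ->
           forall (d : measure_display) (Omega : measurableType d)
                  (P : probability Omega R) (W : R -> Omega -> 'rV[R]_3),
             brownian_motion P W -> mean_deformation P W nu (u r) (M r)) &
        (fun r : R => ereal_sup [set Calpha_norm alpha (M r t) | t in [set t : R | 0 < t]])
          @ (0 : R)^'+ --> +oo%E].
Proof.
(* A natural number exceeding 1 / r, so that large [N] corresponds to small [r]. *)
pose N (r : R) := Num.bound r^-1.
have N_gt (r : R) : 0 < r -> r^-1 < (N r)%:R.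
  by move=> r0; apply: archi_boundP; rewrite invr_ge0 ltW.
have N_gt0 (r : R) : 0 < r -> (0 < N r)%N.
  by move=> r0; rewrite -(ltr0n R) (lt_trans _ (N_gt r r0))// invr_gt0.
exists 1, (fun r => shear (@wave_k (N r)) (@wave_l (N r)) nu (amplitude (N r))),
  (fun r => shear_mean_gradient (@wave_k (N r)) (@wave_l (N r)) nu (amplitude (N r))).
split => // [r /andP[r0 _]|r _ d Omega P W BM|].
- exact: shear_solution_concentrated (N_gt0 r r0).
- have [V [mV cV VW]] := brownian_continuous_version BM.
  exact: (mean_deformation_shear _ _ BM mV cV VW).
apply: (@cvg_powR_blowup _ alpha (increment_bound nu)) => // [|r /andP[r0 _]].
  by rewrite /increment_bound !mulr_gt0 ?pi_gt0 ?sqrtr_gt0 ?expR_gt0.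
have N0 := N_gt0 r r0; have NR0 : 0 < (N r)%:R :> R by rewrite ltr0n.
pose h : R := (4 * (N r)%:R)^-1.
have h0 : 0 < h by rewrite invr_gt0 mulr_gt0.
have dist : torus_dist (h *: delta_mx 0 1) 0 = h.
  apply: torus_dist_shift; rewrite h0 /= /h lef_pV2 ?posrE ?mulr_gt0//.
  have : (1 : R) <= (N r)%:R by rewrite ler1n.
  lra.
(* The separation 1 / (4 N) is at most r, so the lower bound in terms of h implies the one in terms
   of r that [cvg_powR_blowup] asks for. *)
have hr : h <= r.
  rewrite -[leRHS]invrK lef_pV2 ?posrE ?invr_gt0 ?mulr_gt0//.
  apply: le_trans (ltW (N_gt r r0)) _; rewrite ler_peMl ?ler0n//; lra.
apply: (@le_trans _ _ (Calpha_norm alpha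
    (shear_mean_gradient (@wave_k (N r)) (@wave_l (N r)) nu (amplitude (N r)) ((N r)%:R ^- 2)))).
  have d0 : 0 < torus_dist (h *: delta_mx 0 1) 0 by rewrite dist.
  apply: le_trans (le_Calpha_norm alpha _ 0 1 d0); rewrite dist lee_fin.
  apply: ler_pM => //.
  - by rewrite /increment_bound !mulr_ge0 ?pi_ge0 ?sqrtr_ge0 ?expR_ge0.
  - by rewrite invr_ge0 powR_ge0.
  - exact: mean_gradient_increment.
  - rewrite lef_pV2 ?posrE ?powR_gt0//.
    by apply: ge0_ler_powR; rewrite ?nnegrE ?(ltW alpha_gt0) ?(ltW h0) ?(ltW r0).
by apply: ereal_sup_ubound; exists ((N r)%:R ^- 2) => //=; rewrite invr_gt0 exprn_gt0.
Qed.
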